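(* Consider the semi-linear non-autonomous SDE $$dX(t)=A(t)X(t)\,dt+\sum_{m=0}^{M} g_m(X(t),t)\star dW_m(t),\qquad X(t_0)=x_0\in\mathbb{R}^d,$$ and one step, of step size $h$, from $Y_0=x_0$ at time $t_0$, of the exponential integrator with $s$ stages $$H_i = Z_{i0}(A;t_0,h)\,Y_0+\sum_{m=0}^{M}\sum_{j=1}^{s} Z_{ij}^{(m)}(A;t_0,h)\,g_m(H_j,t_0+c_jh),\qquad i=1,\dots,s,$$ $$Y_1 = z_0(A;t_0,h)\,Y_0+\sum_{m=0}^{M}\sum_{i=1}^{s} z_i^{(m)}(A;t_0,h)\,g_m(H_i,t_0+c_ih).$$ Assume that each of the ($d\times d$ matrix-valued) method coefficients $Z_{i0}$, $Z_{ij}^{(m)}$, $z_0$, $z_i^{(m)}$ ($i,j=1,\dots,s$, $m=0,\dots,M$) can be written as a B-series of the form $$Z(A;t_0,h)\,x_0=\sum_{\tau\in\bar T_A}\alpha(\tau)\cdot Z(\tau)(h)\cdot F(\tau)(x_0,t_0)$$ (with its own scalar weight functions, denoted by the same letter: $Z_{i0}(\tau)(h)$, $Z_{ij}^{(m)}(\tau)(h)$, $z_0(\tau)(h)$, $z_i^{(m)}(\tau)(h)$), and that $Z_{i0}(\emptyset)=z_0(\emptyset)\equiv 1$ for $i=1,\dots,s$. Then the stage values $H_i$ and the numerical solution $Y_1$ after one step can be written as B-series $$H_i=B(\Phi_i,x_0,t_0;h),\quad i=1,\dots,s,\qquad Y_1=B(\Phi,x_0,t_0;h),$$ where the weight functions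 are given recursively by $$\Phi_i(\emptyset)(h)=\Phi(\emptyset)(h)=1,$$ $$\Phi_i(\bullet_m)(h)=\sum_{j=1}^{s}Z_{ij}^{(m)}(\emptyset)(h),\qquad \Phi_i(\bullet_t)(h)=c_ih,\qquad i=1,\dots,s,$$ $$\Phi(\bullet_m)(h)=\sum_{i=1}^{s}z_i^{(m)}(\emptyset)(h),$$ $$\Phi_i(\tau)(h)=\begin{cases} Z_{i0}(\tau)(h) & \text{if }\tau\in\bar T_A,\\ \sum_{j=1}^{s}Z_{ij}^{(m)}(\vartheta)(h)\cdot\prod_{k=1}^{\kappa}\Phi_j(\tau_k)(h) & \text{otherwise},\end{cases}$$ $$\Phi(\tau)(h)=\begin{cases} z_{0}(\tau)(h) & \text{if }\tau\in\bar T_A,\\ \sum_{i=1}^{s}z_{i}^{(m)}(\vartheta)(h)\cdot\prod_{k=1}^{\kappa}\Phi_i(\tau_k)(h) & \text{otherwise},\end{cases}$$ where, for $\tau\in T\setminus\bar T_A$, $(\vartheta,\{\delta\})$ is the unique decomposition of $\tau$ into a subtree $\vartheta\in\bar T_A$ containing the root of $\tau$ (or $\vartheta=\emptyset$) and a single remaining tree $\delta=[\tau_1,\dots,\tau_\kappa]_m\in T_g$.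
   Context: Setting. $A(t)\in\mathbb{R}^{d\times d}$ is a matrix function (no commutativity assumed) and $g_m:\mathbb{R}^d\times\mathbb{R}\to\mathbb{R}^d$, $m=0,\dots,M$; all are sufficiently smooth and the conditions of the existence and uniqueness theorem for SDEs hold. $dW_0(t)=dt$, and $W_1,\dots,W_M$ are pairwise independent one-dimensional Wiener processes; $\star\,dW_m$ denotes either the Itô or the Stratonovich integral. The method coefficients may be random (e.g. depend on Wiener increments); $c_1,\dots,c_s$ are real numbers. Trees. Trees are unordered, rooted, with nodes of types $\bullet_0,\dots,\bullet_M$ (representing $g_0,\dots,g_M$), $\bullet_A$ (representing $A(t)X$) and $\bullet_t$ (representing $t$). $[\tau_1,\dots,\tau_\kappa]_m$ (resp. $[\tau_1,\dots,\tau_\kappa]_A$) is the tree obtained by joining $\tau_1,\dots,\tau_\kappa$ each by a single branch to a common root $\bullet_m$ (resp. $\bullet_A$); with $\kappa=0$ this is $\bullet_m$ (resp. $\bullet_A$). $\bullet_t^{k}$ means $k$ copies of $\bullet_t$. The set $T=\{\emptyset\}\cup T_g\cup T_A$ is defined recursively by: - $\bullet_m\in T_g$ for $m=0,\dots,M$, and $\bullet_A\in T_A$; - $[\tau_1,\dots,\tau_\kappa]_m\in T_g$ for $m=0,\dots,M$ if $\tau_1,\dots,\tau_\kappa\in (T\setminus\{\emptyset\})\cup\{\bullet_t\}$; - $[\tau_1,\bullet_t^{\kappa-1}]_A\in T_A$, $\kappa\ge 1$, if $\tau_1\in (T\setminus\{\emptyset\})\cup\{\bullet_t\}$. $\bar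 T_A\subset T$ is the subset of trees (including $\emptyset$) containing no node $\bullet_m$, $m=0,\dots,M$. Combinatorial coefficients. $\alpha(\emptyset)=\alpha(\bullet_m)=\alpha(\bullet_A)=\alpha(\bullet_t)=1$, and for a tree $\tau$ with root subtrees $\tau_1,\dots,\tau_\kappa$, $\alpha(\tau)=\frac{1}{v_1!v_2!\cdots v_K!}\prod_{k=1}^{\kappa}\alpha(\tau_k)$, where $v_1,\dots,v_K$ count equal trees among $\tau_1,\dots,\tau_\kappa$. Elementary differentials. $F(\emptyset)(x_0,t_0)=x_0$, $F(\bullet_m)(x_0,t_0)=g_m(x_0,t_0)$, $F(\bullet_A)(x_0,t_0)=A(t_0)x_0$, $F(\bullet_t)(x_0,t_0)=1$, $$F([\tau_1,\dots,\tau_\kappa]_m)(x_0,t_0)=(D_\tau g_m)(x_0,t_0)\big(F(\tau_1)(x_0,t_0),\dots,F(\tau_\kappa)(x_0,t_0)\big),$$ where $D_\tau g_m$ is the partial derivative of $g_m$ of order $\kappa$ (a multilinear map) taken once with respect to $x$ for each $\tau_k\in T$ and once with respect to $t$ for each $\tau_k=\bullet_t$; and $$F([\tau_1,\bullet_t^{\kappa-1}]_A)(x_0,t_0)=\begin{cases}A^{(\kappa)}(t_0)x_0&\text{if }\tau_1=\bullet_t,\\ A^{(\kappa-1)}(t_0)F(\tau_1)(x_0,t_0)&\text{otherwise,}\end{cases}$$ with $A^{(k)}$ the $k$-th derivative of $A$. B-series. $B(\phi,x_0,t_0;h)=\sum_{\tau\in T}\alpha(\tau)\cdot\phi(\tau)(h)\cdot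 F(\tau)(x_0,t_0)$, where the weights $\phi(\tau)(h)$ are scalar functions of $h$ (possibly random variables). B-series are understood as formal series; as a standing assumption, all elementary differentials exist and all considered B-series converge. Decomposition $(\vartheta,\{\delta\})$. Each node $\bullet_A$ of a tree in $T$ has at most one child that is not $\bullet_t$. For $\tau\in T\setminus\bar T_A$, starting from the root and following these children through nodes $\bullet_A$, one reaches a first node of some type $\bullet_m$; $\delta=[\tau_1,\dots,\tau_\kappa]_m$ is the full subtree of $\tau$ hanging from that node (with $\kappa=0$ and empty product equal to $1$ if $\delta=\bullet_m$), and $\vartheta\in\bar T_A$ is the tree left after removing $\delta$ from $\tau$. If the root of $\tau$ is $\bullet_m$, then $\vartheta=\emptyset$ and $\delta=\tau$. *)

(* Defs.v *)
From HB Require Import structures.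
From mathcomp Require Import all_boot all_order all_algebra.
From mathcomp Require Import all_classical all_reals all_analysis.

Set Implicit Arguments.
Unset Strict Implicit.
Unset Printing Implicit Defensive.

Import Order.TTheory GRing.Theory Num.Theory.
Import numFieldNormedType.Exports.

Local Open Scope classical_set_scope.
Local Open Scope ring_scope.

(* [Gnode m ts] is [ts]_m and [Anode ts] is [ts]_A; with [ts = [::]] they are
   the single nodes.  [Tempty] is the empty tree and [Tnode] the node of type t.
   A term of this type is an ordered tree over all node types; [inT] below
   selects the trees of T. *)
Inductive tree (M : nat) : Type :=
| Tempty
| Tnode
| Gnode of 'I_M.+1 & seq (tree M)
| Anode of seq (tree M).
Arguments Tempty {M}.
Arguments Tnode {M}.
Arguments Gnode {M} m ts.
Arguments Anode {M} ts.

Section Trees.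
Variable M : nat.
Local Notation tree := (tree M).

Fixpoint tree_encode (u : tree) : GenTree.tree unit :=
  match u with
  | Tempty => GenTree.Node 0 [::]
  | Tnode => GenTree.Node 1 [::]
  | Anode ts => GenTree.Node 2 [seq tree_encode c | c <- ts]
  | Gnode m ts => GenTree.Node m.+3 [seq tree_encode c | c <- ts]
  end.

Fixpoint tree_decode (u : GenTree.tree unit) : tree :=
  match u with
  | GenTree.Leaf _ => Tempty
  | GenTree.Node 0 _ => Tempty
  | GenTree.Node 1 _ => Tnode
  | GenTree.Node 2 us => Anode [seq tree_decode c | c <- us]
  | GenTree.Node (m.+3) us => Gnode (inord m) [seq tree_decode c | c <- us]
  end.

Lemma tree_encodeK : cancel tree_encode tree_decode.
Proof.
rewrite /cancel; fix IH 1; case=> [||m ts|ts] //=.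
- rewrite inord_val; congr (Gnode m).
  by elim: ts => [//|c ts IHts] /=; rewrite (IH c) IHts.
- congr Anode.
  by elim: ts => [//|c ts IHts] /=; rewrite (IH c) IHts.
Qed.

HB.instance Definition _ := Countable.copy tree (can_type tree_encodeK).

Definition is_t (u : tree) : bool := if u is Tnode then true else false.

(* An arbitrary total order.  Trees are unordered, so every unordered tree is
   represented by its unique representative in which the root subtrees of each
   node form a nondecreasing sequence. *)
Definition tree_le : rel tree := fun u v => (pickle u <= pickle v)%N.

(* T without the empty tree.  The root subtrees of a node of type A are
   tau_1 and copies of the node of type t, that is, at most one of them is not
   of type t. *)
Fixpoint inT1 (u : tree) : bool :=
  match u with
  | Tempty | Tnode => false
  | Gnode _ ts => all (fun c => is_t c || inT1 c) ts && sorted tree_le ts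
  | Anode ts => [&& all (fun c => is_t c || inT1 c) ts,
                    (count (fun c => ~~ is_t c) ts <= 1)%N
                  & sorted tree_le ts]
  end.

Definition inT (u : tree) : bool := (u == Tempty) || inT1 u.

Fixpoint has_g (u : tree) : bool :=
  match u with
  | Tempty | Tnode => false
  | Gnode _ _ => true
  | Anode ts => has has_g ts
  end.

Definition inTA (u : tree) : bool := inT u && ~~ has_g u.

Fixpoint nodes (u : tree) : nat :=
  match u with
  | Tempty => 0
  | Tnode => 1
  | Gnode _ ts | Anode ts => (sumn [seq nodes c | c <- ts]).+1
  end.

(* The decomposition (theta, {delta}) of a tree of T that contains a node of
   type g: [delta u] is found by following the child that is not of type t
   through the nodes of type A, and [theta u] is what remains of [u]. *)
Fixpoint delta (u : tree) : tree :=
  match u with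
  | Anode ts => foldr (fun c d => if is_t c then d else delta c) Tempty ts
  | _ => u
  end.

Fixpoint theta (u : tree) : tree :=
  match u with
  | Anode ts =>
      Anode (sort tree_le
        (pmap (fun c => if is_t c then Some c
                        else if theta c is Tempty then None
                        else Some (theta c)) ts))
  | _ => Tempty
  end.

Fixpoint alpha (R : realType) (u : tree) : R :=
  match u with
  | Tempty | Tnode => 1
  | Gnode _ ts | Anode ts =>
      (\prod_(c <- undup ts) ((count_mem c ts)`!)%:R)^-1
      * \prod_(a <- [seq alpha R c | c <- ts]) a
  end.

End Trees.

(* D^k f (vs_1, ..., vs_k) as a function of the base point *)
Fixpoint Dn (R : realType) (W V : normedModType R) (f : W -> V) (vs : seq W)
    : W -> V :=
  match vs with
  | [::] => f
  | v :: vs' => fun p => 'D_v (Dn f vs') p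
  end.

(* C^infinity: every iterated directional derivative is differentiable *)
Definition smooth (R : realType) (W V : normedModType R) (f : W -> V) : Prop :=
  forall (vs : seq W) (p : W), differentiable (Dn f vs) p.

Section ElementaryDifferentials.
Variables (R : realType) (d M : nat).
Local Notation vec := 'cV[R]_d.
Variables (A : R -> 'M[R]_d) (g : 'I_M.+1 -> vec -> R -> vec).

Definition uncurry_g (m : 'I_M.+1) : vec * R -> vec := fun p => g m p.1 p.2.

(* A root subtree [c] of a node of type g contributes one derivative of g_m in
   x, applied to F(c), or, when [c] is the node of type t, one derivative in t,
   applied to F(c) = 1: these are the directions (F(c), 0) and (0, 1) of
   R^d x R.  Since F of the node of type t is the scalar 1 and not a vector, it
   appears only through this direction, and the value of [F] at [Tnode] below
   is never used. *)
Fixpoint F (u : tree M) (x : vec) (t : R) {struct u} : vec :=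
  match u with
  | Tempty => x
  | Tnode => 0
  | Gnode m ts =>
      Dn (uncurry_g m)
         [seq (if is_t c then (0, 1) else (F c x t, 0)) : vec * R | c <- ts]
         (x, t)
  | Anode ts =>
      if all (@is_t M) ts then derive1n (size ts) A t *m x
      else derive1n (size ts).-1 A t
             *m foldr (fun c v => if is_t c then v else F c x t) 0 ts
  end.

(* The part of order [n] (trees of [D] with [n] nodes) of
   sum_{u in D} alpha(u) phi(u) F(u)(x, t); there are finitely many such trees
   for [D] included in T.  A formal series is the sequence of its homogeneous
   parts. *)
Definition Bpart (D : {pred tree M}) (phi : tree M -> R) (x : vec) (t : R)
    (n : nat) : vec :=
  \sum_(u \in [set u | u \in D /\ nodes u = n])
     (alpha R u * phi u) *: F u x t.

Definition Bseries (phi : tree M -> R) (x : vec) (t : R) : nat -> vec :=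
  Bpart (@inT M) phi x t.

(* The B-series over [D] converges (absolutely, as a sum over the trees of [D])
   and its sum is [v]. *)
Definition Bsum (D : {pred tree M}) (phi : tree M -> R) (x : vec) (t : R)
    (v : vec) : Prop :=
  ((\esum_(u in [set u | u \in D]) (`|(alpha R u * phi u) *: F u x t|%:E)
      < +oo)%E)
  /\ (series (Bpart D phi x t) @ \oo --> v).

End ElementaryDifferentials.

Section FormalSeries.
Variables (R : realType).

Definition mul_fs (d : nat) (Z : nat -> 'M[R]_d) (v : nat -> 'cV[R]_d) (n : nat)
    : 'cV[R]_d :=
  \sum_(a < n.+1) Z a *m v (n - a)%N.

(* Composition of the Taylor series of [f] at P_0 with the formal series
   [P = P_0 + P_1 + ...]: the part of order [n] of
   sum_k 1/k! D^k f(P_0)(P - P_0, ..., P - P_0). *)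
Definition taylor_fs (W V : normedModType R) (f : W -> V) (P : nat -> W)
    (n : nat) : V :=
  \sum_(k < n.+1) (k`!%:R)^-1 *:
    \sum_(ns : k.-tuple 'I_n.+1 |
            all (fun i : 'I_n.+1 => (0 < i)%N) ns
            && (sumn [seq val i | i <- ns] == n))
      Dn f [seq P (val i) | i <- ns] (P 0%N).

(* multiplication by a quantity of order one *)
Definition shift_fs (V : nmodType) (v : nat -> V) (n : nat) : V :=
  if n is n'.+1 then v n' else 0.

(* the argument (H, t + e) of g, where the time increment [e] has order one *)
Definition point_fs (d : nat) (t e : R) (H : nat -> 'cV[R]_d) (n : nat)
    : 'cV[R]_d * R :=
  (H n, if n is 0 then t else if n is 1 then e else 0).

End FormalSeries.

(* The coefficients Z_{i0}, Z_{ij}^{(m)}, z_0, z_i^{(m)} of a method with [s]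
   stages.  [X] is the type of matrices, of formal series of matrices, or of
   weight functions. *)
Record coeffs (M s : nat) (X : Type) := Coeffs {
  cZ0 : 'I_s -> X;
  cZ : 'I_M.+1 -> 'I_s -> 'I_s -> X;
  cz0 : X;
  cz : 'I_M.+1 -> 'I_s -> X }.

Definition coeffs_rel (M s : nat) (X Y : Type) (r : X -> Y -> Prop)
    (a : coeffs M s X) (b : coeffs M s Y) : Prop :=
  [/\ forall i, r (cZ0 a i) (cZ0 b i),
      forall m i j, r (cZ a m i j) (cZ b m i j),
      r (cz0 a) (cz0 b)
    & forall m i, r (cz a m i) (cz b m i)].

Section Method.
Variables (R : realType) (d M s : nat).
Local Notation vec := 'cV[R]_d.
Variables (A : R -> 'M[R]_d) (g : 'I_M.+1 -> vec -> R -> vec).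
Variables (c : 'I_s -> R) (x0 : vec) (t0 : R).

Definition step (h : R) (Z : coeffs M s 'M[R]_d) (H : 'I_s -> vec) (Y : vec)
    : Prop :=
  (forall i, H i = cZ0 Z i *m x0
     + \sum_(m < M.+1) \sum_(j < s) cZ Z m i j *m g m (H j) (t0 + c j * h))
  /\ Y = cz0 Z *m x0
     + \sum_(m < M.+1) \sum_(i < s) cz Z m i *m g m (H i) (t0 + c i * h).

(* The Taylor expansion at (x0, t0) of g_m(H_j, t0 + c_j h), for a formal
   series [H] starting with x0. *)
Definition g_fs (h : R) (H : 'I_s -> nat -> vec) (m : 'I_M.+1) (j : 'I_s)
    : nat -> vec :=
  taylor_fs (uncurry_g g m) (point_fs t0 (c j * h) (H j)).

(* The same step for formal series.  The order of a term is the number of nodes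
   of its tree, so every occurrence of g_m counts for one; this is the
   [shift_fs].  The sum of the homogeneous parts gives back [step]. *)
Definition step_fs (h : R) (Z : coeffs M s (nat -> 'M[R]_d))
    (H : 'I_s -> nat -> vec) (Y : nat -> vec) : Prop :=
  (forall i n, H i n = cZ0 Z i n *m x0
     + \sum_(m < M.+1) \sum_(j < s)
         mul_fs (cZ Z m i j) (shift_fs (g_fs h H m j)) n)
  /\ (forall n, Y n = cz0 Z n *m x0
     + \sum_(m < M.+1) \sum_(i < s)
         mul_fs (cz Z m i) (shift_fs (g_fs h H m i)) n).

(* Z x = sum over the trees of T without nodes of type g of
   alpha(u) w(u) F(u)(x, t0), for every vector x, as formal series and as
   convergent series. *)
Definition coeff_fs (Z : nat -> 'M[R]_d) (w : tree M -> R) : Prop :=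
  forall n (x : vec), Z n *m x = Bpart A g (@inTA M) w x t0 n.

Definition coeff_sum (Z : 'M[R]_d) (w : tree M -> R) : Prop :=
  forall x : vec, Bsum A g (@inTA M) w x t0 (Z *m x).

End Method.

Definition weight (M : nat) (R : realType) (d : measure_display)
    (Omega : measurableType d) (P : probability Omega R) : Type :=
  tree M -> R -> {RV P >-> R}.

Definition weight_at (M : nat) (R : realType) (d : measure_display)
    (Omega : measurableType d) (P : probability Omega R)
    (h : R) (w : Omega) (phi : weight M P) : tree M -> R :=
  fun u => phi u h w.

Definition coeffs_at (M s : nat) (R : realType) (d : measure_display)
    (Omega : measurableType d) (P : probability Omega R)
    (h : R) (w : Omega) (Z : coeffs M s (weight M P))
    : coeffs M s (tree M -> R) :=
  Coeffs (fun i => weight_at h w (cZ0 Z i))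
         (fun m i j => weight_at h w (cZ Z m i j))
         (weight_at h w (cz0 Z))
         (fun m i => weight_at h w (cz Z m i)).

Definition weight_recursion (M s : nat) (R : realType) (d : measure_display)
    (Omega : measurableType d) (P : probability Omega R)
    (c : 'I_s -> R) (Z : coeffs M s (weight M P))
    (Phis : 'I_s -> weight M P) (Phi : weight M P) : Prop :=
  forall (h : R) (w : Omega),
  [/\ (forall i, Phis i Tempty h w = 1) /\ Phi Tempty h w = 1,
      (forall i m, Phis i (Gnode m [::]) h w = \sum_(j < s) cZ Z m i j Tempty h w)
      /\ (forall i, Phis i Tnode h w = c i * h),
      forall m, Phi (Gnode m [::]) h w = \sum_(i < s) cz Z m i Tempty h w,
      forall u, inTA u ->
        (forall i, Phis i u h w = cZ0 Z i u h w) /\ Phi u h w = cz0 Z u h w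
    & forall u m ts, inT u -> ~~ inTA u -> delta u = Gnode m ts ->
        (forall i, Phis i u h w =
           \sum_(j < s) cZ Z m i j (theta u) h w
                        * \prod_(v <- ts) Phis j v h w)
        /\ Phi u h w =
           \sum_(i < s) cz Z m i (theta u) h w
                        * \prod_(v <- ts) Phis i v h w].

(* Main.v *)
Require Import Defs.
From HB Require Import structures.
From mathcomp Require Import all_boot all_order all_algebra.
From mathcomp Require Import all_classical all_reals all_analysis.
From mathcomp Require Import measurable_realfun ring.

Set Implicit Arguments.
Unset Strict Implicit.
Unset Printing Implicit Defensive.

Import Order.TTheory GRing.Theory Num.Theory.
Import numFieldNormedType.Exports.

Local Open Scope classical_set_scope.
Local Open Scope ring_scope.

(** Every quantity of the step is expanded in elementary differentials and
compared order by order, the order of a term being its number of nodes.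

A tree [u] of T is a chain of nodes of type A, each with some leaves of type t,
ending in a root of type g or in nothing.  Building such a chain one A-node at a
time ([stem], [T_stem_ind]) shows that everything splits along the
decomposition: the number of nodes is additive, [alpha] is multiplicative, and
[F u x = F (theta u) (F (delta u) x)] with [F (theta u)] linear
([F_theta_delta], [alpha_theta_delta]).  Since [u |-> (theta u, delta u)] is a
bijection between the trees with a node of type g and the pairs of a tree
without such nodes and a tree of T_g ([sum_theta_delta]), a coefficient matrix
applied to a series over T_g is again a B-series, with the products of the
weights.

It remains to see that [g_m (H_j, t0 + c_j h)] is a series over T_g with weight
[\prod_k Phi_j (tau_k)] at [tau_1, ..., tau_k] joined to a root of type m.  The
k-th term of its Taylor series is [1/k!] times the k-th derivative at k copies of
[H_j - x0] and of the time increment.  Multilinearity ([Dn_multilinear]) turns it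
into a sum over words of k root subtrees; by the symmetry of iterated derivatives
([Dn_perm], a consequence of Clairaut's theorem) the words that are permutations
of one another contribute equally, and a multiset with multiplicities v_1, ...,
v_K comes from k! / (v_1! ... v_K!) words ([sum_words_sorted]), which produces
exactly [alpha] ([taylor_trees]).

So the B-series satisfy the equations of the step ([Bseries_recursion]).  They
are the only formal series that do: every occurrence of g raises the order by
one, so the equations determine the part of order n of the stages from the parts
of lower order ([step_fs_unique]).

For convergent series the products of the formal step are Cauchy products of a
coefficient series, which converges absolutely, with the series of g_m, which
is only assumed to converge; Mertens' theorem ([mertens]) gives the sum.
Finally, the weights exist as random variables because the recursion only adds
and multiplies random variables along subtrees ([weight_recursion_exists]). *)

(** * Symmetry and multilinearity of iterated derivatives *)

Lemma close_of_scaled_bounds (R : realFieldType) (D q a b e : R) : 0 < q ->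
  `|D - q * a| <= e / 2 * q -> `|D - q * b| <= e / 2 * q -> `|a - b| <= e.
Proof.
move=> q0 Da Db; rewrite -(ler_pM2l q0) -{1}[q]gtr0_norm// -normrM.
have -> : q * (a - b) = (D - q * b) - (D - q * a) by ring.
rewrite (le_trans (ler_normB _ _))// (le_trans (lerD Db Da))//.
by rewrite -mulrDl -splitr mulrC.
Qed.

Section Clairaut.
Variables (R : realType) (W : normedModType R).

(** The second difference is the increment of
[s |-> f (p + s u + h v) - f (p + s u)] between 0 and h; by the mean value
theorem it is h times a difference of values of ['D_u f] near p, to which the
differentiability of ['D_u f] at p applies. *)
Lemma second_difference_bound (f : W -> R) (p u v : W) :
  (forall q, differentiable f q) -> differentiable ('D_u f) p ->
  forall e : R, 0 < e -> exists2 r : R, 0 < r & forall h, 0 < h < r ->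
    `|f (p + h *: u + h *: v) - f (p + h *: u) - f (p + h *: v) + f p
      - h ^+ 2 * 'D_v ('D_u f) p| <= e * h ^+ 2.
Proof.
move=> df ddf e e0.
(* [h * C] bounds both increments of the base point at which the differential of
   ['D_u f] is used; the two errors add up to [2 * C * e' * h]. *)
set C := `|u| + `|v|.
have C0 : 0 <= C by rewrite addr_ge0.
have C1 : 0 < 2 * C + 1 by rewrite ltr_wpDl// mulr_ge0.
set e' := e / (2 * C + 1).
have e'0 : 0 < e' by rewrite divr_gt0.
have := diff_locallyx ddf; set L := 'd _ p => Hdf.
have /nbhs_ballP[r /= r0 Hr] : \forall k \near (0 : W),
    `|'D_u f (k + p) - 'D_u f p - L k| <= e' * `|k|.
  near=> k.
  rewrite Hdf (_ : forall a b c : R, a + b + c - a - b = c); last by move=> *; ring.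
  by near: k; apply: littleoP.
have {}Hr k : `|k| < r -> `|'D_u f (k + p) - 'D_u f p - L k| <= e' * `|k|.
  by move=> kr; apply: Hr; rewrite -ball_normE /= sub0r normrN.
exists (r / (C + 1)); first by rewrite divr_gt0// ltr_wpDl.
move=> h /andP[h0]; rewrite ltr_pdivlMr ?ltr_wpDl// => hr.
have hC : h * C < r by apply: le_lt_trans hr; rewrite ler_pM2l// lerDl.
pose G (s : R) : R := f (s *: u + (h *: v + p)) - f (s *: u + p).
pose G' (s : R) : R := 'D_u f (s *: u + (h *: v + p)) - 'D_u f (s *: u + p).
have line q (s : R) : is_derive s 1 (fun x : R => f (x *: u + q))
    ('D_u f (s *: u + q)).
  have df1 : derivable f (s *: u + q) u by apply: diff_derivable.
  have E : (fun k : R => k^-1 *: (((fun x : R => f (x *: u + q)) \o shift s)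
             (k *: 1) - f (s *: u + q))) =
           (fun k : R => k^-1 *: ((f \o shift (s *: u + q)) (k *: u)
             - f (s *: u + q))).
    by apply/funext => k /=; rewrite [_%:A]mulr1 scalerDl addrA.
  by split; rewrite /derivable /derive E.
have dG (s : R) : is_derive s (1 : R) G (G' s) by apply: is_deriveB.
have cG : {within `[0, h], continuous G}.
  apply: derivable_within_continuous => x _; exact: ex_derive.
have [xi xi_in] := MVT h0 (fun x _ => dG x) cG.
rewrite /G /G' subr0 scale0r !add0r => HG.
have {}HG : f (p + h *: u + h *: v) - f (p + h *: u) - f (p + h *: v) + f p
   = G' xi * h.
  rewrite -HG -[p + _ + _]addrA ![p + _]addrC -[h *: u + _ + p]addrA.
  by rewrite opprB [RHS]addrA [RHS]addrAC.
rewrite HG.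
have /andP[xi0 xih] : 0 < xi < h by move: xi_in; rewrite in_itv.
have bnd1 : `|xi *: u| <= h * C.
  rewrite normrZ gtr0_norm// ler_pM ?(ltW xi0) ?(ltW xih)// /C lerDl//.
have bnd2 : `|xi *: u + h *: v| <= h * C.
  rewrite (le_trans (ler_normD _ _))// !normrZ !gtr0_norm// /C mulrDr lerD2r.
  by rewrite ler_wpM2r// ltW.
have B1 := Hr _ (le_lt_trans bnd1 hC).
have B2 := Hr _ (le_lt_trans bnd2 hC).
have -> : 'D_v ('D_u f) p = L v by rewrite deriveE.
have -> : G' xi * h - h ^+ 2 * L v =
  h * (('D_u f (xi *: u + h *: v + p) - 'D_u f p - L (xi *: u + h *: v))
       - ('D_u f (xi *: u + p) - 'D_u f p - L (xi *: u))).
  have aux (a b c lu lv : R) : (a - b) * h - h ^+ 2 * lv =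
      h * ((a - c - (xi * lu + h * lv)) - (b - c - xi * lu)) by ring.
  rewrite /G' [xi *: u + (_ + _)]addrA linearD /=.
  rewrite ![L (xi *: _)]linearZ [L (h *: _)]linearZ /=.
  exact: aux.
rewrite normrM gtr0_norm// expr2 mulrCA ler_pM2l//.
rewrite (le_trans (ler_normB _ _))//.
apply: (@le_trans _ _ (e' * (h * C) + e' * (h * C))).
  by rewrite lerD// (le_trans B1, le_trans B2)// ler_pM2l.
have -> : e' * (h * C) + e' * (h * C) = (e' * h) * (2 * C) by ring.
have -> : e * h = (e' * h) * (2 * C + 1).
  by rewrite mulrAC /e' divfK// gt_eqF.
by rewrite ler_wpM2l ?lerDl// mulr_ge0// ltW.
Unshelve. all: by end_near. Qed.

(** The second difference is symmetric in [u] and [v], and both mixed derivatives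
are its limit after division by [h ^+ 2]. *)
Lemma clairaut_scalar (f : W -> R) (p u v : W) :
  (forall q, differentiable f q) ->
  differentiable ('D_u f) p -> differentiable ('D_v f) p ->
  'D_v ('D_u f) p = 'D_u ('D_v f) p.
Proof.
move=> df du dv; apply/eqP; rewrite -subr_eq0 -normr_le0.
apply/ler_addgt0Pl => e e0; rewrite addr0.
have e2 : 0 < e / 2 by rewrite divr_gt0.
have [r r0 Hr] := second_difference_bound v df du e2.
have [r' r'0 Hr'] := second_difference_bound u df dv e2.
have m0 : 0 < Num.min r r' by rewrite lt_min r0.
pose h := Num.min r r' / 2.
have h0 : 0 < h by rewrite divr_gt0.
have hm : h < Num.min r r' by rewrite ltr_pdivrMr// ltr_pMr// ltrDl.
have {}Hr := Hr h; have {}Hr' := Hr' h.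
move: hm; rewrite lt_min => /andP[hr hr'].
move: Hr Hr'; rewrite h0 hr hr' => /(_ isT) B1 /(_ isT) B2.
have h20 : 0 < h ^+ 2 by rewrite exprn_gt0.
have {}B2 : `|f (p + h *: u + h *: v) - f (p + h *: u) - f (p + h *: v) + f p
    - h ^+ 2 * 'D_u ('D_v f) p| <= e / 2 * h ^+ 2.
  move: B2; rewrite [p + h *: v + h *: u]addrAC.
  by rewrite [_ - f (p + h *: v) - f (p + h *: u)]addrAC.
apply: close_of_scaled_bounds h20 B1 B2.
Qed.

End Clairaut.

Fixpoint words (T : Type) (K : seq T) (k : nat) : seq (seq T) :=
  if k is k'.+1 then [seq c :: w | c <- K, w <- words K k'] else [:: [::]].

Section IteratedDerivatives.
Variables (R : realType) (W : normedModType R) (d : nat).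
Implicit Types f : W -> 'cV[R]_d.

(** The mean value theorem fails for vector-valued functions, so
these are reduced to their coordinates. *)
Lemma derive_coord f (w : W) i j : (forall q, differentiable f q) ->
  (fun q => 'D_w f q i j) = (fun q => 'D_w (fun q => f q i j : R) q) :> (W -> R).
Proof.
move=> df; apply/funext => q.
by rewrite derive_mx ?mxE//; exact: diff_derivable.
Qed.

Lemma differentiable_comp_coord f i j : (forall q, differentiable f q) ->
  forall q, differentiable (fun x => f x i j : R) q.
Proof.
move=> df q; apply: (@differentiable_comp _ _ _ _ f
  (fun N : 'M[R]_(d, 1) => N i j : R)) => //.
exact: differentiable_coord.
Qed.

Lemma derive2_coord f (w w' p : W) i j :
  (forall q, differentiable f q) -> (forall q, differentiable ('D_w f) q) ->
  'D_w' ('D_w f) p i j = 'D_w' ('D_w (fun q => f q i j : R)) p :> R.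
Proof.
move=> df dw; have E := derive_coord w i j df.
have E' := derive_coord w' i j dw.
rewrite -[LHS]/((fun q => 'D_w' ('D_w f) q i j) p) E'.
by rewrite -[RHS]/('D_w' (fun q => 'D_w (fun q => f q i j : R) q) p) -E.
Qed.

Lemma clairaut f (u v p : W) :
  (forall q, differentiable f q) ->
  (forall q, differentiable ('D_u f) q) ->
  (forall q, differentiable ('D_v f) q) ->
  'D_v ('D_u f) p = 'D_u ('D_v f) p.
Proof.
move=> df du dv.
have dD i j w : (forall q, differentiable ('D_w f) q) ->
    differentiable ('D_w (fun q => f q i j : R)) p.
  by move=> dw; have := differentiable_comp_coord i j dw p; rewrite (derive_coord w i j df).
have E i j : 'D_v ('D_u (fun q => f q i j : R)) p = 'D_u ('D_v (fun q => f q i j : R)) p :> R.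
  by apply: clairaut_scalar; [exact: differentiable_comp_coord|exact: dD|exact: dD].
apply/matrixP => i j.
apply: (etrans (derive2_coord v p i j df du)).
apply: (etrans (E i j)).
exact: esym (derive2_coord u p i j df dv).
Qed.

Variable f : W -> 'cV[R]_d.
Hypothesis f_smooth : smooth f.

Lemma Dn_swap (u v : W) vs : Dn f (u :: v :: vs) = Dn f (v :: u :: vs).
Proof.
apply/funext => p /=; apply: clairaut => q; first exact: (f_smooth vs).
  exact: (f_smooth (v :: vs)).
exact: (f_smooth (u :: vs)).
Qed.

Lemma Dn_perm (vs ws : seq W) : perm_eq vs ws -> Dn f vs = Dn f ws.
Proof.
have move_front s1 s2 v : Dn f (s1 ++ v :: s2) = Dn f (v :: s1 ++ s2).
  elim: s1 => [//|u s1 IH]; rewrite cat_cons cat_cons Dn_swap.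
  by rewrite -[LHS]/(fun p => 'D_u (Dn f (s1 ++ v :: s2)) p) IH.
elim: vs ws => [|v vs IH] ws; first by rewrite perm_sym => /perm_nilP ->.
move=> pvw; have vw : v \in ws by rewrite -(perm_mem pvw) mem_head.
case/splitPr: vw pvw => s1 s2 pvw; rewrite move_front /=.
have /IH -> // : perm_eq vs (s1 ++ s2).
rewrite -(perm_cons v) (perm_trans pvw)//.
by rewrite -cat1s perm_catCA.
Qed.

Lemma derive_bigsum (I : Type) (r : seq I) (P : pred I) (a : I -> R)
    (F : I -> W -> 'cV[R]_d) (x p : W) :
  (forall i q, differentiable (F i) q) ->
  'D_x (fun q => \sum_(i <- r | P i) a i *: F i q) p =
  \sum_(i <- r | P i) a i *: 'D_x (F i) p.
Proof.
move=> dF; suff [] : differentiable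
    (fun q => \sum_(i <- r | P i) a i *: F i q) p /\
    'D_x (fun q => \sum_(i <- r | P i) a i *: F i q) p =
    \sum_(i <- r | P i) a i *: 'D_x (F i) p by [].
elim: r => [|i r [IHd IH]].
  have -> : (fun q => \sum_(i <- [::] | P i) a i *: F i q) = cst 0.
    by apply/funext => q; rewrite big_nil.
  by rewrite big_nil derive_cst; split => //; exact: differentiable_cst.
rewrite big_cons; case: ifP => Pi; last first.
  have -> // : (fun q => \sum_(j <- i :: r | P j) a j *: F j q) =
               (fun q => \sum_(j <- r | P j) a j *: F j q).
  by apply/funext => q; rewrite big_cons Pi.
have -> : (fun q => \sum_(j <- i :: r | P j) a j *: F j q) =
    (a i *: F i) + (fun q => \sum_(j <- r | P j) a j *: F j q).
  by apply/funext => q; rewrite big_cons Pi.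
have dZ : differentiable (a i *: F i) p by exact: differentiableZ.
split; first exact: differentiableD.
by rewrite deriveD ?deriveZ ?IH//; exact: diff_derivable.
Qed.

(** Expanding each of the directions, which are sums over the letters of [K] with
a prescribed value of [nd], gives one term for each word with these values. *)
Lemma Dn_multilinear (T : Type) (K : seq T) (nd : T -> nat) (a : T -> R)
    (dir : T -> W) (ns : seq nat) :
  Dn f [seq \sum_(c <- K | nd c == n) a c *: dir c | n <- ns] =
  (fun p => \sum_(w <- words K (size ns) | map nd w == ns)
     (\prod_(c <- w) a c) *: Dn f (map dir w) p).
Proof.
elim: ns => [|n ns IH] /=.
  by apply/funext => p; rewrite big_mkcond big_seq1 eqxx big_nil scale1r.
apply/funext => p; rewrite /= IH derive_bigsum; last first.
  by move=> w q; exact: f_smooth.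
transitivity (\sum_(w <- words K (size ns) | map nd w == ns)
    \sum_(c <- K | nd c == n)
      (\prod_(c <- w) a c) *: (a c *: 'D_(dir c) (Dn f (map dir w)) p)).
  apply: eq_bigr => w _; have dDn := f_smooth (map dir w) p.
  rewrite -scaler_sumr deriveE// linear_sum; congr (_ *: _).
  by apply: eq_bigr => c _; rewrite linearZ deriveE.
rewrite exchange_big /= [RHS]big_mkcond big_allpairs_dep [LHS]big_mkcond /=.
apply: eq_bigr => c _; case: (nd c =P n) => [<-|nc]; last first.
  by rewrite big1// => w _; case: eqP => // -[/nc].
rewrite -big_mkcond; apply: eq_big => [w|w _]; first by rewrite eqseq_cons eqxx.
by rewrite scalerA big_cons mulrC.
Qed.

End IteratedDerivatives.

(** * Words and multisets *)

Section Words.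
Variable T : eqType.
Implicit Types (K w s : seq T).

Lemma mem_words K k w : (w \in words K k) = (size w == k) && all [in K] w.
Proof.
elim: k w => [|k IH] w /=; first by rewrite inE; case: w.
apply/allpairsP/andP => [[[c v] /= [cK vk ->]]|[]].
  by move: vk; rewrite IH /= cK eqSS => /andP[].
case: w => [//|c v] /= /eqP[sv] /andP[cK vK]; exists (c, v).
by split=> //=; rewrite IH sv eqxx.
Qed.

Lemma words_uniq K k : uniq K -> uniq (words K k).
Proof.
move=> uK; elim: k => [//|k IH] /=.
by apply: allpairs_uniq => // -[a b] [a' b'] _ _ /= [-> ->].
Qed.

(** Permutations are sorted by their first letter. *)
Lemma size_permutations_rec s : s != [::] ->
  size (permutations s) = \sum_(x <- undup s) size (permutations (rem x s)).
Proof.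
move=> s0.
pose L := flatten [seq [seq x :: t | t <- permutations (rem x s)] | x <- undup s].
have /perm_size -> : perm_eq (permutations s) L.
  apply: uniq_perm; first exact: permutations_uniq.
    rewrite /L.
    have := @allpairs_uniq_dep T (fun=> seq T) (seq T) (fun x t => x :: t)
      (undup s) (fun x => permutations (rem x s)).
    apply; first exact: undup_uniq.
      by move=> x _; exact: permutations_uniq.
    by move=> [a b] [a' b'] _ _ /= [-> ->].
  move=> t; rewrite mem_permutations; apply/idP/flatten_mapP.
    case: t => [|x t pt]; first by rewrite perm_sym => /perm_nilP E; rewrite E in s0.
    have xs : x \in s by rewrite -(perm_mem pt) mem_head.
    exists x; first by rewrite mem_undup.
    apply: map_f; rewrite mem_permutations -(perm_cons x) (perm_trans pt)//.
    exact: perm_to_rem.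
  move=> [x]; rewrite mem_undup => xs /mapP[t' + ->].
  rewrite mem_permutations => pt; rewrite perm_sym (perm_trans (perm_to_rem xs))//.
  by rewrite perm_cons perm_sym.
rewrite /L size_flatten /shape -map_comp sumnE big_map.
by apply: eq_bigr => x _; rewrite /= size_map.
Qed.

(** This is the product v_1! ... v_K! in the denominator of [alpha]. *)
Definition mult_fact s : nat := \prod_(x <- undup s) (count_mem x s)`!.

Lemma mult_fact_widen s r : uniq r -> {subset s <= r} ->
  mult_fact s = \prod_(x <- r) (count_mem x s)`!.
Proof.
move=> ur sr; rewrite [RHS](bigID [in s]) /= [X in _ = muln _ X]big1 ?muln1; last first.
  by move=> x xs; rewrite (count_memPn xs).
rewrite -big_filter; apply: perm_big; apply: uniq_perm => //.
- exact: undup_uniq.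
- exact: filter_uniq.
move=> x; rewrite mem_undup mem_filter; case xs: (x \in s) => //=.
by rewrite sr.
Qed.

Lemma mult_fact_rem s x : x \in s ->
  mult_fact s = (count_mem x s * mult_fact (rem x s))%N.
Proof.
move=> xs; rewrite (@mult_fact_widen (rem x s) (undup s)) ?undup_uniq//; last first.
  by move=> y /mem_rem; rewrite mem_undup.
have xu : x \in undup s by rewrite mem_undup.
rewrite /mult_fact !(bigD1_seq x)//= ?undup_uniq// mulnA; congr (_ * _)%N.
  rewrite count_rem xs /= eqxx subn1; case E: (count_mem x s) => [|n] //=.
  by move: xs; rewrite -has_pred1 has_count E.
apply: eq_bigr => y yx; rewrite count_rem xs /= [x == y]eq_sym (negbTE yx).
by rewrite subn0.
Qed.

Lemma mult_fact_perm s s' :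
  perm_eq s s' -> mult_fact s = mult_fact s'.
Proof.
move=> ss'; rewrite (@mult_fact_widen s (undup s')) ?undup_uniq//.
  by apply: eq_bigr => x _; rewrite (permP ss').
by move=> x; rewrite mem_undup (perm_mem ss').
Qed.

Lemma mult_fact_nseq (x : T) k : mult_fact (nseq k x) = k`!.
Proof.
elim: k => [|k IH]; first by rewrite /mult_fact big_nil.
have xk : x \in nseq k.+1 x by rewrite mem_head.
by rewrite (mult_fact_rem xk) count_nseq /= eqxx IH mul1n factS.
Qed.

(** By induction on the size: the permutations that start with [x] contribute
[count_mem x s * (size s).-1`!], and the multiplicities add up to [size s]. *)
Lemma size_permutations_mult s :
  (size (permutations s) * mult_fact s = (size s)`!)%N.
Proof.
have [n] := ubnP (size s); elim: n s => [//|n IH] s.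
have [->|s0 sn] := eqVneq s [::]; first by rewrite /mult_fact big_nil.
rewrite size_permutations_rec// big_distrl /=.
transitivity (\sum_(x <- undup s) count_mem x s * (size s).-1`!)%N.
  rewrite big_seq [RHS]big_seq; apply: eq_bigr => x; rewrite mem_undup => xs.
  rewrite (mult_fact_rem xs) mulnCA IH ?size_rem//.
  by case: (s) s0 sn.
rewrite -big_distrl /=; have -> : (\sum_(x <- undup s) count_mem x s)%N = size s.
  under eq_bigr do rewrite -sum1_count big_mkcond.
  rewrite exchange_big -sum1_size /= big_seq [RHS]big_seq.
  apply: eq_bigr => y ys; rewrite -big_mkcond /= sum1_count.
  under eq_count do rewrite eq_sym.
  by rewrite (count_uniq_mem y (undup_uniq s)) mem_undup ys.
by case: (s) s0 => //= a l _; rewrite factS.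
Qed.

Section Symmetrize.
Variables (le : rel T) (R : numFieldType) (V : lmodType R).
Hypotheses (le_total : total le) (le_trans : transitive le)
  (le_anti : antisymmetric le).

(** Sorting a word selects a representative of its multiset, and the multiset of
[s] has [k`! / mult_fact s] words.  This turns the factor 1/k! of a Taylor
coefficient into the symmetry factor of unordered trees. *)
Lemma sum_words_sorted (K : seq T) (k : nat) (G : seq T -> V) : uniq K ->
  (forall w w', perm_eq w w' -> G w = G w') ->
  (k`!%:R)^-1 *: \sum_(w <- words K k) G w =
  \sum_(s <- words K k | sorted le s) (mult_fact s)%:R^-1 *: G s.
Proof.
move=> uK Gsym.
have sort_words w : w \in words K k -> sort le w \in words K k.
  by rewrite !mem_words size_sort all_sort.
transitivity ((k`!%:R)^-1 *: \sum_(w <- words K k)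
    \sum_(s <- words K k | sorted le s) if sort le w == s then G s else 0).
  congr (_ *: _); rewrite big_seq [RHS]big_seq; apply: eq_bigr => w wK.
  rewrite -big_mkcondr /=.
  rewrite -big_filter.
  have -> : [seq s <- words K k | sorted le s & sort le w == s] = [:: sort le w].
    apply: perm_small_eq => //; apply: uniq_perm => //.
      by rewrite filter_uniq// words_uniq.
    move=> s; rewrite mem_filter inE [s == _]eq_sym.
    have [<-|] := eqVneq (sort le w) s; last by rewrite andbF.
    by rewrite sort_sorted// sort_words.
  by rewrite big_seq1; apply: Gsym; rewrite perm_sym perm_sort.
rewrite exchange_big scaler_sumr /= big_seq_cond [RHS]big_seq_cond.
apply: eq_bigr => s /andP[sK ss].
rewrite -big_mkcond /= big_const_seq iter_addr_0.
have -> : count (fun w => sort le w == s) (words K k) = size (permutations s).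
  rewrite -size_filter; apply: perm_size; apply: uniq_perm.
  - by rewrite filter_uniq// words_uniq.
  - exact: permutations_uniq.
  move=> w; rewrite mem_filter mem_permutations.
  have -> : (sort le w == s) = perm_eq w s.
    apply/eqP/idP => [<-|pw]; first by rewrite perm_sym perm_sort.
    by rewrite (perm_sortP le_total le_trans le_anti _ _ pw) sorted_sort.
  case pw: (perm_eq w s) => //=; move: sK; rewrite !mem_words.
  by rewrite (perm_size pw) (perm_all _ pw).
have sk : size s = k by move: sK; rewrite mem_words => /andP[/eqP].
rewrite -[G s *+ _]scaler_nat scalerA; congr (_ *: _).
have m0 : (mult_fact s)%:R != 0 :> R.
  have := fact_gt0 k; rewrite -sk -size_permutations_mult muln_gt0 => /andP[_].
  by rewrite pnatr_eq0 lt0n.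
apply: (mulIf m0); rewrite mulVf// -mulrA -natrM size_permutations_mult sk.
by rewrite mulVf// pnatr_eq0 -lt0n fact_gt0.
Qed.
End Symmetrize.
End Words.

(** * Stems, and the decomposition into theta and delta *)

Section Trees.
Variable M : nat.
Local Notation tree := (tree M).
Local Notation tree_le := (@tree_le M).
Local Notation Tempty := (@Tempty M).
Local Notation Tnode := (@Tnode M).

Lemma tree_le_total : total tree_le.
Proof. by move=> u v; exact: leq_total. Qed.

Lemma tree_le_trans : transitive tree_le.
Proof. by move=> u v w; exact: leq_trans. Qed.

Lemma tree_le_anti : antisymmetric tree_le.
Proof. by move=> u v; rewrite -eqn_leq => /eqP/(pcan_inj pickleK). Qed.

Lemma tree_sort_eq (s s' : seq tree) :
  perm_eq s s' -> sort tree_le s = sort tree_le s'.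
Proof. by move/(perm_sortP tree_le_total tree_le_trans tree_le_anti). Qed.

Lemma tree_sort_sorted (s : seq tree) : sorted tree_le (sort tree_le s).
Proof. exact: sort_sorted tree_le_total _. Qed.

Lemma tree_sortedE (s s' : seq tree) :
  sorted tree_le s -> perm_eq s s' -> s = sort tree_le s'.
Proof. by move=> ss /tree_sort_eq <-; rewrite sorted_sort//; exact: tree_le_trans. Qed.

Lemma is_tE (c : tree) : is_t c = (c == Tnode).
Proof. by case: c => // [m ts|ts]; apply/esym/negP => /eqP. Qed.

Lemma inT1_is_t (c : tree) : inT1 c -> ~~ is_t c. Proof. by case: c. Qed.

Lemma inT_is_t (c : tree) : inT c -> ~~ is_t c.
Proof. by case/orP => [/eqP->//|/inT1_is_t]. Qed.

Lemma inT1E (c : tree) : inT1 c = inT c && (c != Tempty).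
Proof. by rewrite /inT; case: eqP => [->|_] //=; rewrite andbT. Qed.

Lemma inT1_inT (u : tree) : inT1 u -> inT u.
Proof. by rewrite /inT => ->; rewrite orbT. Qed.

(** The empty tree stands for an absent child, so that [stem k Tempty] is the
A-node with [k] leaves of type t and needs no separate treatment. *)
Definition opt_seq (c : tree) : seq tree := if c is Defs.Tempty then [::] else [:: c].

Definition stem (k : nat) (c : tree) : tree :=
  Anode (sort tree_le (opt_seq c ++ nseq k Tnode)).

Lemma opt_seqE c : opt_seq c = if c == Tempty then [::] else [:: c].
Proof. by case: c => // [m ts|ts]; case: eqP. Qed.

Lemma stem_filter k c : ~~ is_t c ->
  [seq b <- sort tree_le (opt_seq c ++ nseq k Tnode) | ~~ is_t b] = opt_seq c.
Proof.
move=> ct; apply: perm_small_eq; first by case: c {ct}.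
rewrite (perm_trans (perm_filter _ (permEl (perm_sort _ _))))//.
rewrite filter_cat filter_nseq cats0.
by case: c ct => //= [m ts|ts].
Qed.

Lemma foldr_nont (X : Type) (f : tree -> X) (z : X) (s : seq tree) :
  foldr (fun c v => if is_t c then v else f c) z s =
  foldr (fun c _ => f c) z [seq c <- s | ~~ is_t c].
Proof. by elim: s => //= c s ->; case: (is_t c). Qed.

Lemma foldr_stem (X : Type) (f : tree -> X) (z : X) k c : ~~ is_t c ->
  foldr (fun c v => if is_t c then v else f c) z
    (sort tree_le (opt_seq c ++ nseq k Tnode)) =
  if c is Defs.Tempty then z else f c.
Proof. by move=> ct; rewrite foldr_nont stem_filter//; case: c ct. Qed.

Lemma nodes_stem k c : nodes (stem k c) = (k.+1 + nodes c)%N.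
Proof.
rewrite /= (perm_sumn (perm_map _ (permEl (perm_sort _ _)))).
rewrite map_cat sumn_cat map_nseq sumn_nseq mul1n addSn addnC; congr (_ + _).+1.
by case: c => //= *; rewrite addn0.
Qed.

Lemma has_g_stem k c : has_g (stem k c) = has_g c.
Proof.
rewrite /= (perm_has _ (permEl (perm_sort _ _))) has_cat has_nseq andbF orbF.
by case: c => //= *; rewrite orbF.
Qed.

Lemma inT1_stem k c : inT c -> inT1 (stem k c).
Proof.
move=> cT; have := inT_is_t cT => ct.
rewrite /= (perm_all _ (permEl (perm_sort _ _))) (permP (permEl (perm_sort _ _))).
rewrite tree_sort_sorted andbT all_cat count_cat all_nseq count_nseq orbT andbT.
rewrite /= mul0n addn0 opt_seqE; have [//|c0] := eqVneq c Tempty.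
by rewrite /= inT1E cT c0 (negbTE ct).
Qed.

Lemma delta_stem k c : ~~ is_t c -> delta (stem k c) = delta c.
Proof. by move=> ct; rewrite /= foldr_stem//; case: c ct. Qed.

Lemma theta_stem k c : ~~ is_t c -> theta (stem k c) = stem k (theta c).
Proof.
move=> ct; rewrite /= /stem; congr Anode; apply: tree_sort_eq.
rewrite (perm_trans (perm_pmap _ (permEl (perm_sort _ _))))// pmap_cat.
have pE (f : tree -> option tree) : f Tnode = Some Tnode ->
    pmap f (nseq k Tnode) = nseq k Tnode.
  by move=> fE; elim: k => //= k ->; rewrite fE.
rewrite pE// perm_cat2r; case: c ct => //= ts _.
Qed.

(** A left inverse of [stem], which proves [stem] injective. *)
Definition unstem (u : tree) : nat * tree :=
  if u is Anode ts then (count (@is_t M) ts, head Tempty [seq c <- ts | ~~ is_t c])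
  else (0%N, Tempty).

Lemma stemK k c : ~~ is_t c -> unstem (stem k c) = (k, c).
Proof.
move=> ct; rewrite /= stem_filter// (permP (permEl (perm_sort _ _))) count_cat.
rewrite count_nseq mul1n.
by case: c ct => //= [m ts|ts] _; rewrite add0n.
Qed.

(** An A-node of a tree of T has at most one child that is not of type t, and its
children are sorted; hence it is [stem k c] with [c] that child, or the empty
tree if there is none. *)
Lemma T_stem_ind (P : tree -> Prop) :
  P Tempty ->
  (forall m ts, inT (Gnode m ts) -> P (Gnode m ts)) ->
  (forall k c, inT c -> P c -> P (stem k c)) ->
  forall u, inT u -> P u.
Proof.
move=> P0 PG PS u; have [n] := ubnP (nodes u); elim: n u => [//|n IH] u un uT.
case: u un uT => // [m ts|ts] un uT; first exact: PG.
move: (uT) => /orP[/eqP//|/and3P[ts_all ts1 ts_sort]].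
pose c := head Tempty [seq c <- ts | ~~ is_t c].
have cT : inT c.
  rewrite /c; case E: [seq c <- ts | ~~ is_t c] => [//|b s] /=.
  have : b \in [seq c <- ts | ~~ is_t c] by rewrite E mem_head.
  rewrite mem_filter => /andP[bt bts]; have : is_t b || inT1 b := allP ts_all _ bts.
  by rewrite (negbTE bt) orFb; exact: inT1_inT.
have fE : [seq c <- ts | ~~ is_t c] = opt_seq c.
  have : all (fun b => b != Tempty) [seq c <- ts | ~~ is_t c].
    apply/allP => b; rewrite mem_filter => /andP[bt bts].
    have : is_t b || inT1 b := allP ts_all _ bts.
    by rewrite (negbTE bt) orFb inT1E => /andP[].
  move: ts1; rewrite -size_filter /c opt_seqE.
  by case: [seq c <- ts | ~~ is_t c] => [//|b [|//]] _ /= /andP[/negbTE ->].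
have uE : Anode ts = stem (count (@is_t M) ts) c.
  congr Anode; apply: tree_sortedE => //.
  rewrite -fE; have -> : nseq (count (@is_t M) ts) Tnode = [seq c <- ts | is_t c].
    by elim: (ts) => //= b s <-; case: b.
  by rewrite perm_sym perm_catC perm_filterC.
rewrite uE; apply: PS => //; apply: IH => //.
by rewrite -ltnS (leq_trans _ un)// uE nodes_stem ltnS addSn ltnS leq_addl.
Qed.

Implicit Types u v c th de : tree.

Lemma theta_inTA u : inT u -> inTA (theta u).
Proof.
move: u; apply: T_stem_ind => [//|m ts _|k c cT IH]; first by rewrite /inTA.
case/andP: IH => thT thg; rewrite theta_stem ?inT_is_t// /inTA has_g_stem thg.
by rewrite /inT inT1_stem// orbT.
Qed.

Lemma theta_inT u : inT u -> inT (theta u).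
Proof. by move=> /theta_inTA/andP[]. Qed.

Lemma theta_not_t u : inT u -> ~~ is_t (theta u).
Proof. by move=> uT; have /andP[/inT_is_t] := theta_inTA uT. Qed.

Lemma delta_inT u : inT u -> inT (delta u).
Proof.
move: u; apply: T_stem_ind => [//|m ts //|k c cT IH].
by rewrite delta_stem ?inT_is_t.
Qed.

Definition is_g (u : tree) : bool := if u is Gnode _ _ then true else false.

Lemma delta_is_g u : inT u -> is_g (delta u) = has_g u.
Proof.
move: u; apply: T_stem_ind => [//|m ts //|k c cT IH].
by rewrite delta_stem ?inT_is_t// has_g_stem.
Qed.

Lemma nodes_theta_delta u : inT u -> nodes u = (nodes (theta u) + nodes (delta u))%N.
Proof.
move: u; apply: T_stem_ind => [//|m ts //|k c cT IH].
by rewrite theta_stem ?inT_is_t// delta_stem ?inT_is_t// !nodes_stem IH addnA.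
Qed.

(** Both trees are stripped of their A-nodes in parallel: [theta] records the
numbers of leaves, and the roots of type g that remain are the values of
[delta]. *)
Lemma theta_delta_inj u v : inT u -> inT v -> has_g u -> has_g v ->
  theta u = theta v -> delta u = delta v -> u = v.
Proof.
move=> uT vT; move: u uT v vT; apply: T_stem_ind => [//|m ts _|k c cT IH].
  apply: T_stem_ind => [//|m' ts' _ //|k' c' c'T _].
  by move=> _ _; rewrite theta_stem ?inT_is_t.
move=> v vT; move: v vT; apply: T_stem_ind => [//|m' ts' _|k' c' c'T _].
  by move=> _ _; rewrite theta_stem ?inT_is_t.
rewrite !has_g_stem !theta_stem ?inT_is_t// !delta_stem ?inT_is_t//.
move=> cg c'g th_eq de_eq.
have := congr1 unstem th_eq; rewrite !stemK ?theta_not_t// => -[-> th_eq'].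
by rewrite (IH c').
Qed.

(** Grafting: [de] replaces the empty tree at the end of the chain [th]. *)
Lemma theta_delta_surj th de : inTA th -> inT de -> is_g de ->
  exists u, [/\ inT u, has_g u, theta u = th & delta u = de].
Proof.
move=> /andP[]; move: th; apply: T_stem_ind => [_|m ts //|k c cT IH].
  by move=> deT deg; exists de; case: de deT deg.
rewrite has_g_stem => cg deT deg; have [u [uT ug uth ude]] := IH cg deT deg.
exists (stem k u); rewrite has_g_stem theta_stem ?inT_is_t// delta_stem ?inT_is_t//.
by rewrite uth ude /inT inT1_stem// orbT.
Qed.

Section Alpha.
Variable R : realType.

Lemma alphaE (s : seq tree) :
  (\prod_(c <- undup s) ((count_mem c s)`!)%:R)^-1
     * \prod_(a <- [seq alpha R c | c <- s]) a =
  (mult_fact s)%:R^-1 * \prod_(c <- s) alpha R c.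
Proof. by rewrite big_map /mult_fact natr_prod. Qed.

(** Only the leaves of type t occur several times below the root of a stem. *)
Lemma alpha_stem k c : ~~ is_t c -> alpha R (stem k c) = (k`!)%:R^-1 * alpha R c.
Proof.
move=> ct; rewrite -[LHS]/(_^-1 * _) alphaE.
rewrite (mult_fact_perm (permEl (perm_sort _ _))).
rewrite (perm_big _ (permEl (perm_sort _ _))) /= big_cat /=.
have -> : \prod_(b <- nseq k Tnode) alpha R b = 1.
  by rewrite big_nseq; elim: k => //= k ->; rewrite mulr1.
rewrite mulr1 opt_seqE; have [->|c0] := eqVneq c Tempty.
  by rewrite big_nil mult_fact_nseq.
rewrite big_seq1 (mult_fact_rem (mem_head _ _)) /= eqxx count_nseq.
have -> : pred1 c Tnode = false by rewrite /= eq_sym -is_tE (negbTE ct).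
by rewrite mult_fact_nseq mul0n addn0 mul1n.
Qed.

Lemma alpha_theta_delta u : inT u ->
  alpha R u = alpha R (theta u) * alpha R (delta u).
Proof.
move: u; apply: T_stem_ind => [|m ts _|k c cT IH].
- by rewrite mulr1.
- by rewrite [alpha R (theta _)]/= mul1r.
rewrite theta_stem ?inT_is_t// delta_stem ?inT_is_t//.
by rewrite !alpha_stem ?theta_not_t ?inT_is_t// IH mulrA.
Qed.

End Alpha.

Section ElementaryDifferential.
Variables (R : realType) (d : nat) (A : R -> 'M[R]_d)
  (g : 'I_M.+1 -> 'cV[R]_d -> R -> 'cV[R]_d).

Lemma F_stem k c x t : ~~ is_t c ->
  F A g (stem k c) x t = derive1n k A t *m F A g c x t.
Proof.
move=> ct; rewrite /= size_sort (perm_all _ (permEl (perm_sort _ _))) foldr_stem//.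
rewrite all_cat all_nseq orbT andbT size_cat size_nseq opt_seqE.
have [->|c0] := eqVneq c Tempty; first by rewrite /= add0n.
by rewrite /= (negbTE ct) /=; case: c ct c0.
Qed.

(** The matrices [A^(k)] of the chain [theta u] act on [F (delta u) x] in place of
[x]; this also holds when [u] has no node of type g, because then [delta u] is
the empty tree and [F Tempty x = x]. *)
Lemma F_theta_delta u x t : inT u ->
  F A g u x t = F A g (theta u) (F A g (delta u) x t) t.
Proof.
move: u; apply: T_stem_ind => [//|m ts //|k c cT IH].
rewrite theta_stem ?inT_is_t// delta_stem ?inT_is_t// !F_stem ?theta_not_t ?inT_is_t//.
by rewrite IH.
Qed.

Lemma F_TA_linear u t : inTA u -> linear (fun x => F A g u x t).
Proof.
move=> /andP[]; move: u; apply: T_stem_ind => [//|m ts //|k c cT IH].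
rewrite has_g_stem => /IH lin a x y.
by rewrite !F_stem ?inT_is_t// lin mulmxDr scalemxAr.
Qed.

Lemma F_TA_scale u t b y : inTA u -> F A g u (b *: y) t = b *: F A g u y t.
Proof.
move=> uTA; have lin : linear (fun x => F A g u x t) := F_TA_linear t uTA.
have lin0 : F A g u 0 t = 0.
  by have := lin (-1) 0 0; rewrite scaler0 addr0 => ->; rewrite scaleN1r addNr.
by have := lin b y 0; rewrite addr0 lin0 addr0.
Qed.

Lemma F_TA_sum (I : Type) (r : seq I) (Q : pred I) (f : I -> 'cV[R]_d) u t : inTA u ->
  F A g u (\sum_(i <- r | Q i) f i) t = \sum_(i <- r | Q i) F A g u (f i) t.
Proof.
move=> uTA; apply: (big_morph (fun x => F A g u x t)) => [x y|].
  by have := F_TA_linear t uTA 1 x y; rewrite !scale1r.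
by rewrite -[X in F A g u X](scale0r 0) F_TA_scale// scale0r.
Qed.

End ElementaryDifferential.

(** * Finite lists of trees *)

(** The list only has to contain all the trees that may be root subtrees and have
at most [N] nodes: every node counts for one, so such a tree has at most [N - 1]
children, with at most [N - 1] nodes each.  Trees outside T are filtered out
below. *)
Fixpoint ordered_tree_list (N : nat) : seq tree :=
  if N is N'.+1 then
    let forests := flatten [seq words (ordered_tree_list N') k | k <- iota 0 N] in
    Tnode :: [seq Anode ts | ts <- forests] ++
      [seq Gnode m ts | m <- enum 'I_M.+1, ts <- forests]
  else [::].

Lemma nodes_gt0 c : is_t c || inT1 c -> (0 < nodes c)%N.
Proof. by case: c. Qed.

Lemma leq_nodes_sumn c (ts : seq tree) :
  c \in ts -> (nodes c <= sumn [seq nodes c | c <- ts])%N.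
Proof.
by move=> cts; rewrite (perm_sumn (perm_map _ (perm_to_rem cts))) /= leq_addr.
Qed.

Lemma size_leq_sumn (ts : seq tree) : all (fun c => is_t c || inT1 c) ts ->
  (size ts <= sumn [seq nodes c | c <- ts])%N.
Proof.
elim: ts => //= c ts IH /andP[cT /IH sz].
by rewrite -add1n leq_add// nodes_gt0.
Qed.

Lemma mem_ordered_tree_list N c :
  is_t c || inT1 c -> (nodes c <= N)%N -> c \in ordered_tree_list N.
Proof.
elim: N c => [|N IH] c cT cN.
  by have := leq_trans (nodes_gt0 cT) cN.
have forest ts : all (fun c => is_t c || inT1 c) ts ->
    (sumn [seq nodes c | c <- ts] <= N)%N ->
    ts \in flatten [seq words (ordered_tree_list N) k | k <- iota 0 N.+1].
  move=> tsT tsN; apply/flatten_mapP; exists (size ts).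
    by rewrite mem_iota ltnS (leq_trans (size_leq_sumn tsT)).
  rewrite mem_words eqxx; apply/allP => b bts; apply: IH.
    exact: (allP tsT).
  exact: leq_trans (leq_nodes_sumn bts) tsN.
case: c cT cN => [//|_ _|m ts /andP[tsT _] tsN|ts /and3P[tsT _ _] tsN].
- by rewrite mem_head.
- rewrite inE mem_cat; apply/orP; right; apply/orP; right.
  by apply: allpairs_f; [exact: mem_enum|exact: forest].
- rewrite inE mem_cat; apply/orP; right; apply/orP; left.
  by apply: map_f; exact: forest.
Qed.

(** The trees that may hang below a root: those of T except the empty tree, and
the node of type t. *)
Definition branch_list N : seq tree :=
  [seq c <- undup (ordered_tree_list N) | (is_t c || inT1 c) && (nodes c <= N)%N].

Lemma mem_branch_list N c : (c \in branch_list N) = (is_t c || inT1 c) && (nodes c <= N)%N.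
Proof.
rewrite mem_filter mem_undup andb_idr// => /andP[cT cN].
exact: mem_ordered_tree_list.
Qed.

Lemma branch_list_uniq N : uniq (branch_list N). Proof. by rewrite filter_uniq// undup_uniq. Qed.

Definition T_list N : seq tree := Tempty :: [seq c <- branch_list N | ~~ is_t c].

Lemma mem_T_list N u : (u \in T_list N) = inT u && (nodes u <= N)%N.
Proof.
rewrite /T_list inE mem_filter mem_branch_list /inT; have [->//|u0] := eqVneq u Tempty.
by rewrite !orFb; case: u {u0} => // *; rewrite andbF.
Qed.

Lemma T_list_uniq N : uniq (T_list N).
Proof.
rewrite /T_list /= filter_uniq ?branch_list_uniq// andbT mem_filter mem_branch_list /=.
by [].
Qed.

(** A sum over a set is 0 by convention when infinitely many terms are nonzero, so
it has to be replaced by a sum over an explicit list; any bound [N >= n] is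
allowed in order to use one list for all orders. *)
Lemma BpartE (R : realType) (d : nat) (A : R -> 'M[R]_d)
    (g : 'I_M.+1 -> 'cV[R]_d -> R -> 'cV[R]_d) (D : {pred tree}) phi x t n N :
  {subset D <= @inT M} -> (n <= N)%N ->
  Bpart A g D phi x t n =
  \sum_(u <- T_list N | (u \in D) && (nodes u == n)) (alpha R u * phi u) *: F A g u x t.
Proof.
move=> DT nN; rewrite /Bpart -[RHS]big_filter [RHS]fsbig_seq ?filter_uniq ?T_list_uniq//.
apply: eq_fsbigl; apply/seteqP; split=> u.
  move=> [uD un]; have uT : inT u := DT _ uD.
  by rewrite /mkset mem_filter mem_T_list uD un eqxx nN uT.
by rewrite /mkset mem_filter => /andP[/andP[uD /eqP un] _].
Qed.

End Trees.

(** * Cauchy products *)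

Lemma series_cauchy_product (R : pzRingType) (a b : nat -> R) n :
  series (fun n => \sum_(k < n.+1) a k * b (n - k)%N) n =
  \sum_(k < n) a k * series b (n - k)%N.
Proof.
elim: n => [|n IH]; first by rewrite /series /= big_geq// big_ord0.
have -> (f : nat -> R) : series f n.+1 = series f n + f n.
  by rewrite /series /= big_nat_recr.
rewrite IH big_ord_recr /= [in RHS]big_ord_recr /= addrA -big_split /=.
congr (_ + _); last by rewrite subnn subSnn /series /= big_nat1.
apply: eq_bigr => k _; rewrite -mulrDr; congr (_ * _).
by rewrite subSn ?(ltnW (ltn_ord k))// /series /= big_nat_recr.
Qed.

Section Mertens.
Variable R : realType.

Lemma abs_series_tail (a : nat -> R) (K : R) :
  (forall n, \sum_(k < n) `|a k| <= K) -> forall e, 0 < e ->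
  exists N, forall n, \sum_(k < n | (N <= k)%N) `|a k| <= e.
Proof.
move=> aK e e0; pose S n := \sum_(k < n) `|a k|.
have S_nd : nondecreasing_seq S.
  apply/nondecreasing_seqP => n; rewrite /S big_ord_recr /= lerDl//.
have S_cvg : cvgn S.
  by apply: nondecreasing_is_cvgn => //; exists K => _ [n _ <-]; exact: aK.
have Sl n : S n <= limn S by exact: nondecreasing_cvgn_le.
have /cvgrPdist_le/(_ e e0)[N _ HN] : S @ \oo --> limn S by [].
exists N => n; have [Nn|nN] := leqP N n; last first.
  rewrite big_pred0 ?ltW// => k; apply/negbTE; rewrite -ltnNge.
  exact: ltn_trans (ltn_ord k) nN.
have := HN N (leqnn N) => /ler_normlP[_]; apply: le_trans.
apply: le_trans (lerB (Sl n) (lexx (S N))).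
rewrite /S [X in _ <= X - _](bigID (fun k : 'I_n => (N <= k)%N)) /= lerBrDr lerD2l.
rewrite (big_ord_widen n (fun k => `|a k|) Nn).
by under [leRHS]eq_bigl do rewrite -ltnNge.
Qed.

(** The difference between the partial sums of the product and [series a n * lb]
is [\sum_k a k * D (n - k)], where [D] is the remainder of [series b].  Terms
with large [k] are small because [a] is absolutely summable and [D] is bounded,
the others because [D (n - k)] is small. *)
Lemma mertens (a b : nat -> R) (K la lb : R) :
  (forall n, \sum_(k < n) `|a k| <= K) ->
  series a @ \oo --> la -> series b @ \oo --> lb ->
  series (fun n => \sum_(k < n.+1) a k * b (n - k)%N) @ \oo --> la * lb.
Proof.
move=> aK a_la b_lb.
pose D n := series b n - lb.
have D0 : D @ \oo --> (0 : R).
  by rewrite -(subrr lb); apply: cvgB => //; exact: cvg_cst.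
have [C C0 DC] : exists2 C, 0 < C & forall n, `|D n| <= C.
  have /cvg_seq_bounded/pinfty_ex_gt0[C C0 DC] : cvgn D by apply/cvg_ex; exists 0.
  by exists C => // n; exact: DC.
have K0 : 0 <= K by have := aK 0%N; rewrite big_ord0.
have E0 : (fun n => \sum_(k < n) a k * D (n - k)%N) @ \oo --> (0 : R).
  apply/cvgrPdist_le => e e0.
  have e1 : 0 < e / 2 / C by rewrite !divr_gt0.
  have [N1 HN1] := abs_series_tail aK e1.
  have e2 : 0 < e / 2 / (K + 1) by rewrite !divr_gt0// ltr_wpDl.
  have /cvgrPdist_le/(_ _ e2)[N2 _ HN2] := D0.
  exists (N1 + N2)%N => // n /= nN; rewrite sub0r normrN.
  rewrite (bigID (fun k : 'I_n => (N1 <= k)%N)) /=.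
  rewrite (le_trans (ler_normD _ _))// [e]splitr lerD//.
    rewrite (le_trans (ler_norm_sum _ _ _))//.
    apply: (@le_trans _ _ (\sum_(k < n | (N1 <= k)%N) `|a k| * C)).
      by apply: ler_sum => k _; rewrite normrM ler_wpM2l.
    by rewrite -mulr_suml -ler_pdivlMr.
  rewrite (le_trans (ler_norm_sum _ _ _))//.
  apply: (@le_trans _ _ (\sum_(k < n) `|a k| * (e / 2 / (K + 1)))).
    rewrite [leRHS](bigID (fun k : 'I_n => (N1 <= k)%N)) /= ler_wpDl//.
      by apply: sumr_ge0 => k _; rewrite mulr_ge0// ltW.
    apply: ler_sum => k; rewrite -ltnNge => kN; rewrite normrM ler_wpM2l//.
    have := HN2 (n - k)%N; rewrite sub0r normrN; apply => /=.
    rewrite leq_subRL ?(ltnW (ltn_ord k))// (leq_trans _ nN)// leq_add2r ltnW//.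
  rewrite -mulr_suml (le_trans (ler_wpM2r (ltW e2) (aK n)))//.
  have e20 : 0 <= e / 2 by rewrite divr_ge0// ltW.
  by rewrite mulrCA ler_piMr// ler_pdivrMr ?ltr_wpDl// mul1r lerDl.
rewrite (_ : series _ = (fun n => series a n * lb) +
    (fun n => \sum_(k < n) a k * D (n - k)%N)).
  by rewrite -[la * lb]addr0; apply: cvgD => //; exact: cvgMl.
apply/funext => n; rewrite series_cauchy_product.
rewrite -[RHS]/(series a n * lb + \sum_(k < n) a k * D (n - k)%N).
rewrite /series /= big_mkord mulr_suml -big_split /=; apply: eq_bigr => k _.
by rewrite -mulrDr addrC subrK.
Qed.

End Mertens.

Lemma entry_le_norm (R : realType) (m n : nat) (Q : 'M[R]_(m, n)) i j : `|Q i j| <= `|Q|.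
Proof.
rewrite [leRHS]/Num.Def.normr/= mx_normrE.
exact: (le_bigmax _ (fun ij : 'I_m * 'I_n => `|Q ij.1 ij.2|) (i, j)).
Qed.

Lemma series_shift (R : realType) (V : normedModType R) (v : nat -> V) (l : V) :
  series v @ \oo --> l -> series (shift_fs v) @ \oo --> l.
Proof.
move=> vl; have E : (fun n => series (shift_fs v) n.+1) = series v.
  by apply/funext => n; rewrite /series /= big_nat_recl//= add0r.
by rewrite -cvg_shiftS E.
Qed.

Section MatrixSeries.
Variables (R : realType) (d : nat).

Lemma cvg_mxP (m n : nat) (f : nat -> 'M[R]_(m, n)) (l : 'M[R]_(m, n)) :
  (forall i j, (fun k => f k i j) @ \oo --> l i j) <-> f @ \oo --> l.
Proof.
split=> [fl|fl i j].
  apply/cvgrPdist_le => e e0; near=> N.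
  rewrite /Num.Def.normr/= mx_normrE (bigmax_le _ (ltW e0))//= => ij _.
  rewrite !mxE; move: ij; near: N; apply: filter_forall => /= ij.
  exact: ((cvgrPdist_le _ _).1 (fl ij.1 ij.2)).
apply: (@cvg_comp _ _ _ f (fun M : 'M[R]_(m, n) => M i j) _ (nbhs l)) => //.
exact: coord_continuous.
Unshelve. all: by end_near. Qed.

Lemma series_coord (m n : nat) (f : nat -> 'M[R]_(m, n)) N i j :
  series f N i j = series (fun k => f k i j) N.
Proof. by rewrite /series /= summxE. Qed.

Lemma mertens_mx (Z : nat -> 'M[R]_d) (v : nat -> 'cV[R]_d) (K : R)
    (lZ : 'M[R]_d) (lv : 'cV[R]_d) :
  (forall i j n, \sum_(k < n) `|Z k i j| <= K) ->
  series Z @ \oo --> lZ -> series v @ \oo --> lv ->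
  series (mul_fs Z v) @ \oo --> lZ *m lv.
Proof.
move=> ZK /cvg_mxP ZlZ /cvg_mxP vlv; apply/cvg_mxP => i j.
have -> : (fun n => series (mul_fs Z v) n i j) = (fun n => \sum_l
    series (fun n => \sum_(k < n.+1) Z k i l * v (n - k)%N l j) n).
  apply/funext => n; rewrite series_coord /series /= exchange_big /=.
  apply: eq_bigr => k _; rewrite /mul_fs summxE exchange_big /=.
  by apply: eq_bigr => a _; rewrite mxE.
rewrite mxE; apply: cvg_big => [|l _]; first exact: add_continuous.
apply: (@mertens R (fun k => Z k i l) (fun k => v k l j) K); first exact: ZK.
  by have := ZlZ i l; under eq_fun do rewrite series_coord.
by have := vlv l j; under eq_fun do rewrite series_coord.
Qed.

End MatrixSeries.

(** * Taylor expansion of g along a B-series *)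

Lemma big_ord_eq (V : nmodType) (n b : nat) (v : V) : (b <= n)%N ->
  \sum_(a < n.+1) (if b == a then v else 0) = v.
Proof.
move=> bn; have bn' : (b < n.+1)%N by [].
rewrite (bigD1 (Ordinal bn'))//= eqxx big1 ?addr0// => i ib.
by case: eqP => // E; move: ib; rewrite -val_eqE /= E eqxx.
Qed.

Lemma taylor_fs_ext (R : realType) (W V : normedModType R) (f : W -> V) (P Q : nat -> W) n :
  (forall k, (k <= n)%N -> P k = Q k) -> taylor_fs f P n = taylor_fs f Q n.
Proof.
move=> PQ; apply: eq_bigr => k _; congr (_ *: _); apply: eq_bigr => ns _.
rewrite PQ//; congr (Dn f _ _); apply: eq_map => i.
by apply: PQ; rewrite -ltnS; exact: ltn_ord.
Qed.

Section FormalSeriesOfTheMethod.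
Variables (R : realType) (d M : nat).
Local Notation vec := 'cV[R]_d.
Local Notation tree := (tree M).
Variables (A : R -> 'M[R]_d) (g : 'I_M.+1 -> vec -> R -> vec).
Hypothesis g_smooth : forall m, smooth (uncurry_g g m).
Variables (x0 : vec) (t0 : R).
Local Notation F := (F A g).
Local Notation Bseries := (Bseries A g).
Local Notation Bpart := (Bpart A g).

Definition root_is (m : 'I_M.+1) (u : tree) : bool :=
  if u is Gnode m' _ then m' == m else false.

Definition kids (u : tree) : seq tree := if u is Gnode _ ts then ts else [::].

Lemma inTA_inT : {subset @inTA M <= @inT M}.
Proof. by move=> u /andP[]. Qed.

Lemma BseriesE phi x t n N : (n <= N)%N -> Bseries phi x t n =
  \sum_(u <- T_list M N | nodes u == n) (alpha R u * phi u) *: F u x t.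
Proof.
move=> nN; rewrite /Defs.Bseries (@BpartE M R d A g (@inT M) phi x t n N)// big_seq_cond.
rewrite [RHS]big_seq_cond; apply: eq_bigl => u.
rewrite mem_T_list; case uT: (inT u) => //=.
by rewrite -[u \in _]/(inT u) uT.
Qed.

Lemma Bseries0 phi x t : phi Tempty = 1 -> Bseries phi x t 0%N = x.
Proof.
move=> phi0; rewrite (@BseriesE _ _ _ 0 0)// /T_list big_cons /= phi0 mulr1 scale1r.
by rewrite big_nil addr0.
Qed.

Section Taylor.
Variables (phi : tree -> R) (m : 'I_M.+1).
Hypothesis phi0 : phi Tempty = 1.
Let e : R := phi Tnode.
Let P : nat -> vec * R := point_fs t0 e (Bseries phi x0 t0).
Let a (c : tree) : R := alpha R c * phi c.
Let dir (c : tree) : vec * R := if is_t c then (0, 1) else (F c x0 t0, 0).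

(** The argument of g_m as a combination of directions: root subtrees of T give
directions in space, and the node of type t, whose weight is the time increment,
gives the direction of time.  The term of order 0 is the base point, which is why
[i] is positive. *)
Lemma point_fs_trees n i : (0 < i <= n)%N ->
  P i = \sum_(c <- branch_list M n | nodes c == i) a c *: dir c.
Proof.
move=> /andP[i0 iN].
have n0 : (0 < n)%N := leq_trans i0 iN.
rewrite [RHS]surjective_pairing /P /point_fs.
rewrite (big_morph (fun p : vec * R => p.1) (id1 := 0) (op1 := +%R))//.
rewrite (big_morph (fun p : vec * R => p.2) (id1 := 0) (op1 := +%R))//.
congr (_, _).
  rewrite (BseriesE _ _ _ iN) /T_list big_cons /= eq_sym (gtn_eqF i0).
  rewrite big_filter_cond big_mkcond [RHS]big_mkcond /=.
  apply: eq_bigr => c _; rewrite /dir; case: (is_t c) => //=.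
  by rewrite scaler0 if_same.
have TK : @Tnode M \in branch_list M n by rewrite mem_branch_list.
rewrite big_mkcond (bigD1_seq Tnode)//= ?branch_list_uniq// big1 ?addr0; last first.
  move=> c ct; rewrite /dir is_tE (negbTE ct) /= [_ *: _]mulr0.
  by rewrite if_same.
by rewrite /a /= !mul1r; case: (i) i0 => [|[|j]] //= _; rewrite [_ *: _]mulr1.
Qed.

(** A word of root subtrees contributes to exactly one tuple of orders, that of the
numbers of nodes of its letters. *)
Lemma tuple_of_nodes n k (w : seq tree) (B : vec) : w \in words (branch_list M n) k ->
  \sum_(ns : k.-tuple 'I_n.+1 | (all (fun i : 'I_n.+1 => (0 < i)%N) ns
        && (sumn [seq val i | i <- ns] == n))
        && (map (@nodes M) w == [seq val i | i <- ns])) B =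
  if sumn (map (@nodes M) w) == n then B else 0.
Proof.
rewrite mem_words => /andP[/eqP sw wK].
have sz : size [seq inord (nodes c) : 'I_n.+1 | c <- w] == k by rewrite size_map sw.
have valE : [seq val i | i <- [seq inord (nodes c) : 'I_n.+1 | c <- w]] = map (@nodes M) w.
  rewrite -map_comp; apply/eq_in_map => c cw /=; rewrite inordK//.
  by have := allP wK _ cw; rewrite mem_branch_list ltnS => /andP[].
case: ifP => [sn|sn]; last first.
  rewrite big_pred0// => ns; apply/negP => /andP[/andP[_ s1] /eqP s2].
  by move: sn; rewrite s2 s1.
rewrite (big_pred1 (Tuple sz))// => ns /=.
apply/andP/eqP => [[_ /eqP wns]|->].
  apply: val_inj; apply: (inj_map val_inj); rewrite -wns; exact: esym valE.
rewrite valE sn eqxx; split=> //; rewrite andbT.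
apply/allP => i /= /mapP[c cw ->].
have := allP wK _ cw; rewrite mem_branch_list => /andP[/nodes_gt0 c0 cn].
by rewrite inordK.
Qed.

Lemma taylor_words n : taylor_fs (uncurry_g g m) P n =
  \sum_(k < n.+1) (k`!%:R)^-1 *:
    \sum_(w <- words (branch_list M n) k)
      if sumn (map (@nodes M) w) == n then
        (\prod_(c <- w) a c) *: Dn (uncurry_g g m) (map dir w) (x0, t0) else 0.
Proof.
rewrite /taylor_fs; apply: eq_bigr => k _; congr (_ *: _).
have -> : P 0%N = (x0, t0) by rewrite /P /point_fs Bseries0.
transitivity (\sum_(ns : k.-tuple 'I_n.+1 |
            all (fun i : 'I_n.+1 => (0 < i)%N) ns
            && (sumn [seq val i | i <- ns] == n))
   \sum_(w <- words (branch_list M n) k | map (@nodes M) w == [seq val i | i <- ns])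
        (\prod_(c <- w) a c) *: Dn (uncurry_g g m) (map dir w) (x0, t0)).
  apply: eq_bigr => ns /andP[ns0 _].
  have -> : [seq P (val i) | i <- ns] =
      [seq \sum_(c <- branch_list M n | nodes c == i) a c *: dir c
         | i <- [seq val i | i <- ns]].
    rewrite -map_comp; apply/eq_in_map => i ins /=; apply: point_fs_trees.
    by rewrite (allP ns0)//= -ltnS.
  by rewrite Dn_multilinear// !size_map size_tuple.
under eq_bigr do rewrite big_mkcond.
rewrite exchange_big /= big_seq [RHS]big_seq; apply: eq_bigr => w wK.
by rewrite -big_mkcondr; exact: tuple_of_nodes.
Qed.

(** A sorted word [w] of root subtrees is the same thing as the tree [Gnode m w].
The root counts for one node, whence the shift from [n] to [n.+1]. *)
Lemma taylor_trees n N : (n < N)%N -> taylor_fs (uncurry_g g m) P n =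
  \sum_(u <- T_list M N | root_is m u && (nodes u == n.+1))
    (alpha R u * \prod_(c <- kids u) phi c) *: F u x0 t0.
Proof.
move=> nN; rewrite taylor_words.
pose X w := (mult_fact w)%:R^-1 *: ((\prod_(c <- w) a c) *:
   Dn (uncurry_g g m) (map dir w) (x0, t0)).
transitivity (\sum_(k < n.+1)
    \sum_(w <- words (branch_list M n) k | sorted (@tree_le M) w
        && (sumn (map (@nodes M) w) == n)) X w).
  apply: eq_bigr => k _; rewrite (sum_words_sorted (@tree_le_total M)
    (@tree_le_trans M) (@tree_le_anti M))//; last 2 first.
  - exact: branch_list_uniq.
  - move=> w w' ww'; rewrite (perm_sumn (perm_map _ ww')); case: ifP => // _.
    by rewrite (perm_big _ ww') (Dn_perm (g_smooth m) (perm_map _ ww')).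
  rewrite [RHS]big_mkcondr; apply: eq_bigr => w _; rewrite /X.
  by case: ifP => //; rewrite scaler0.
rewrite -(big_mkord xpredT (fun k => \sum_(w <- words (branch_list M n) k |
    sorted (@tree_le M) w && (sumn (map (@nodes M) w) == n)) X w)).
transitivity (\sum_(w <- [seq w | k <- index_iota 0 n.+1, w <- words (branch_list M n) k]
    | sorted (@tree_le M) w && (sumn (map (@nodes M) w) == n)) X w).
  rewrite [RHS]big_mkcond big_allpairs_dep; apply: eq_bigr => k _.
  exact: big_mkcond.
rewrite -big_filter -[RHS]big_filter.
set L := (X in \sum_(_ <- X) _); set L' := (X in _ = \sum_(_ <- X) _).
have -> : \sum_(w <- L) X w = \sum_(u <- [seq Gnode m w | w <- L])
    (alpha R u * \prod_(c <- kids u) phi c) *: F u x0 t0.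
  rewrite big_map; apply: eq_bigr => w _; rewrite /X scalerA; congr (_ *: _).
  by rewrite -[alpha R _]/(_^-1 * _) alphaE -mulrA -big_split.
apply: perm_big; apply: uniq_perm.
- rewrite map_inj_uniq => [|? ? []//]; apply: filter_uniq.
  apply: (@allpairs_uniq_dep _ (fun=> seq tree)); first exact: iota_uniq.
    by move=> k _; apply: words_uniq; exact: branch_list_uniq.
  move=> [k w] [k' w'] /allpairsPdep[k1 [w1 [_ + [-> ->]]]].
  move=> + /allpairsPdep[k2 [w2 [_ + [-> ->]]]] /= ww.
  by rewrite !mem_words ww => /andP[/eqP <- _] /andP[/eqP <- _].
- by rewrite filter_uniq// T_list_uniq.
move=> u; rewrite [in RHS]mem_filter mem_T_list.
apply/mapP/andP => [[w + ->]|[/andP[um un] /andP[uT uN]]].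
  rewrite mem_filter => /andP[/andP[ws /eqP wn]] /allpairsPdep[k [w' [_ + E]]].
  rewrite -{}E mem_words => /andP[_ wK]; rewrite /= eqxx wn eqxx nN andbT.
  split=> //; rewrite inT1_inT//; apply/andP; split=> //.
  by apply/allP => c cw; have := allP wK _ cw; rewrite mem_branch_list => /andP[].
case: u um un uT uN => // m' w /eqP -> /eqP[wn] /orP[/eqP//|/andP[wT ws]] _.
exists w => //; rewrite mem_filter ws wn eqxx !andTb; apply/allpairsPdep.
exists (size w), w; split=> //.
  by rewrite mem_index_iota /= ltnS -wn; exact: size_leq_sumn.
rewrite mem_words eqxx; apply/allP => c cw; rewrite mem_branch_list (allP wT)//=.
by rewrite -wn; exact: leq_nodes_sumn.
Qed.

End Taylor.

(** * The recursion for the weights *)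

(** The map [u |-> (theta u, delta u)] is a bijection and adds the numbers of
nodes. *)
Lemma sum_theta_delta (V : nmodType) (n : nat) (X : tree -> tree -> V) :
  \sum_(u <- T_list M n | has_g u && (nodes u == n)) X (theta u) (delta u) =
  \sum_(th <- T_list M n | inTA th)
    \sum_(de <- T_list M n | is_g de && (nodes th + nodes de == n)%N) X th de.
Proof.
pose Y (p : tree * tree) := X p.1 p.2.
pose Lth := [seq th <- T_list M n | inTA th].
pose Lde := [seq de <- T_list M n | is_g de].
transitivity (\sum_(p <- [seq (th, de) | th <- Lth, de <- Lde]
    | (nodes p.1 + nodes p.2 == n)%N) Y p); last first.
  rewrite big_mkcond big_allpairs_dep big_filter; apply: eq_bigr => th _ /=.
  by rewrite big_filter big_mkcondr.
rewrite -big_filter -[RHS]big_filter; set L := (X in _ = \sum_(_ <- X) _).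
rewrite -(big_map (fun u => (theta u, delta u)) xpredT Y).
apply: perm_big; apply: uniq_perm.
- rewrite map_inj_in_uniq ?filter_uniq ?T_list_uniq// => u v.
  rewrite !mem_filter !mem_T_list => /andP[/andP[ug _] /andP[uT _]].
  by move=> /andP[/andP[vg _] /andP[vT _]] [] ? ?; exact: theta_delta_inj.
- rewrite filter_uniq// allpairs_uniq ?filter_uniq ?T_list_uniq//.
  by move=> [? ?] [? ?] _ _ [-> ->].
move=> [th de]; rewrite [in RHS]mem_filter; apply/mapP/andP.
  move=> [u + [-> ->]].
  rewrite mem_filter mem_T_list => /andP[/andP[ug /eqP un] /andP[uT _]].
  have := nodes_theta_delta uT; rewrite un => nE; rewrite -nE eqxx; split=> //.
  apply: allpairs_f; rewrite mem_filter mem_T_list nE.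
    by rewrite theta_inTA//= theta_inT// leq_addr.
  by rewrite delta_is_g// ug delta_inT// leq_addl.
move=> [/eqP thden /allpairsP[[th' de'] [+ + [thE deE]]]]; rewrite -{}thE -{}deE.
rewrite !mem_filter !mem_T_list => /andP[thTA _] /and3P[deg deT _].
have [u [uT ug uth ude]] := theta_delta_surj thTA deT deg.
exists u; last by rewrite uth ude.
rewrite mem_filter mem_T_list ug uT (nodes_theta_delta uT) uth ude.
by rewrite thden eqxx leqnn.
Qed.

Section Recursion.
Variables (s : nat) (e : 'I_s -> R) (Phi : tree -> R) (phis : 'I_s -> tree -> R)
  (Z0 : tree -> R) (Zg : 'I_M.+1 -> 'I_s -> tree -> R).
Hypotheses (phis0 : forall j, phis j Tempty = 1)
  (phist : forall j, phis j Tnode = e j).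
Hypothesis Phi_TA : forall u, inTA u -> Phi u = Z0 u.
Hypothesis Phi_g : forall u m ts, inT u -> ~~ inTA u -> delta u = Gnode m ts ->
  Phi u = \sum_(j < s) Zg m j (theta u) * \prod_(v <- ts) phis j v.

Let g_series m j : nat -> vec :=
  shift_fs (taylor_fs (uncurry_g g m) (point_fs t0 (e j) (Bseries (phis j) x0 t0))).

Lemma g_seriesE m j n N : (n <= N)%N -> g_series m j n =
  \sum_(u <- T_list M N | root_is m u && (nodes u == n))
    (alpha R u * \prod_(c <- kids u) phis j c) *: F u x0 t0.
Proof.
rewrite /g_series -phist; case: n => [|n] nN; last exact: taylor_trees.
by rewrite big1// => u /andP[]; case: u.
Qed.

(* The contribution of the tree [u] with [theta u = th] and [delta u = de]. *)
Let W m j (th de : tree) : vec := (alpha R th * Zg m j th) *: F th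
  ((alpha R de * \prod_(c <- kids de) phis j c) *: F de x0 t0) t0.

(** A coefficient series applied to the series of [g_m], order by order: [F th] is
linear, so it passes through the sum over [de]. *)
Lemma Bpart_g_series m j n :
  \sum_(a < n.+1) Bpart (@inTA M) (Zg m j) (g_series m j (n - a)%N) t0 a =
  \sum_(th <- T_list M n | inTA th)
    \sum_(de <- T_list M n | is_g de && (nodes th + nodes de == n)%N)
      if root_is m de then W m j th de else 0.
Proof.
pose S th := \sum_(de <- T_list M n | root_is m de && (nodes de == n - nodes th)%N)
  W m j th de.
transitivity (\sum_(a < n.+1) \sum_(th <- T_list M n | inTA th)
    if nodes th == a then S th else 0).
  apply: eq_bigr => -[a an] _ /=; rewrite ltnS in an.
  rewrite (BpartE A g _ _ _ inTA_inT an) -big_mkcondr.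
  apply: eq_bigr => th /andP[thTA /eqP tha].
  rewrite (g_seriesE _ _ (leq_subr a n)) F_TA_sum// scaler_sumr /S tha.
  by apply: eq_bigr.
rewrite exchange_big /= big_seq_cond [RHS]big_seq_cond.
apply: eq_bigr => th; rewrite mem_T_list => /andP[/andP[_ thn] _].
rewrite big_ord_eq// /S big_mkcond [RHS]big_mkcond; apply: eq_bigr => de _.
have -> : (nodes de == n - nodes th)%N = (nodes th + nodes de == n)%N.
  by rewrite -(eqn_add2l (nodes th)) subnKC.
by case: de => //= m' ts; case: eqP => //=; case: ifP.
Qed.

(** The trees without nodes of type g give the first term, the others are
decomposed. *)
Lemma Bseries_recursion n : Bseries Phi x0 t0 n =
  Bpart (@inTA M) Z0 x0 t0 n +
  \sum_(m < M.+1) \sum_(j < s) \sum_(a < n.+1)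
     Bpart (@inTA M) (Zg m j) (g_series m j (n - a)%N) t0 a.
Proof.
rewrite (BseriesE _ _ _ (leqnn n)) (bigID (@has_g M)) /= addrC; congr (_ + _).
  rewrite (BpartE A g Z0 x0 t0 inTA_inT (leqnn n)) big_seq_cond [RHS]big_seq_cond.
  apply: eq_big => [u|u /and3P[uL _ ug]].
    rewrite mem_T_list -[u \in @inTA M]/(inTA u) /inTA.
    by case: (inT u); case: (has_g u); case: (nodes u == n); case: leqP.
  rewrite Phi_TA// /inTA ug andbT.
  by move: uL; rewrite mem_T_list => /andP[].
pose X (th de : tree) : vec :=
  \sum_(m < M.+1) if root_is m de then \sum_(j < s) W m j th de else 0.
transitivity (\sum_(u <- T_list M n | has_g u && (nodes u == n)) X (theta u) (delta u)).
  rewrite big_seq_cond [RHS]big_seq_cond; apply: eq_big => [u|u].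
    by rewrite [has_g u && _]andbC.
  rewrite mem_T_list => /andP[/andP[uT _] /andP[_ ug]].
  have uTA : ~~ inTA u by rewrite /inTA ug andbF.
  have dg := delta_is_g uT; rewrite ug in dg.
  rewrite /X; case E: (delta u) dg => [||m0 ts|] // _.
  rewrite (bigD1 m0)//= eqxx [X in _ = _ + X]big1 ?addr0 => [|m mm0]; last first.
    by rewrite /= [m0 == m]eq_sym (negbTE mm0).
  rewrite (Phi_g uT uTA E) mulr_sumr scaler_suml; apply: eq_bigr => j _.
  rewrite /W F_TA_scale ?theta_inTA// scalerA F_theta_delta// E alpha_theta_delta// E.
  congr (_ *: _).
  by rewrite mulrACA.
rewrite sum_theta_delta.
under [RHS]eq_bigr do under eq_bigr do rewrite Bpart_g_series.
under [RHS]eq_bigr do rewrite exchange_big.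
rewrite exchange_big; apply: eq_bigr => th _.
under [RHS]eq_bigr do rewrite exchange_big.
rewrite exchange_big; apply: eq_bigr => de _.
by apply: eq_bigr => m _; case: ifP => // _; rewrite big1.
Qed.

End Recursion.

(** * One step, for formal and for convergent series *)

Section Method.
Variables (s : nat) (c : 'I_s -> R) (h : R) (Zw : coeffs M s (tree -> R)).
Variables (phis : 'I_s -> tree -> R) (Phi : tree -> R).
Hypotheses (phis0 : forall j, phis j Tempty = 1)
  (phist : forall j, phis j Tnode = c j * h).
Hypothesis rec_TA : forall u, inTA u ->
  (forall i, phis i u = cZ0 Zw i u) /\ Phi u = cz0 Zw u.
Hypothesis rec_g : forall u m ts, inT u -> ~~ inTA u -> delta u = Gnode m ts ->
  (forall i, phis i u = \sum_(j < s) cZ Zw m i j (theta u) * \prod_(v <- ts) phis j v)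
  /\ Phi u = \sum_(j < s) cz Zw m j (theta u) * \prod_(v <- ts) phis j v.

Let B i : nat -> vec := Bseries (phis i) x0 t0.

Lemma mul_fs_Bpart (Z : nat -> 'M[R]_d) w v n : coeff_fs A g t0 Z w ->
  mul_fs Z v n = \sum_(a < n.+1) Bpart (@inTA M) w (v (n - a)%N) t0 a.
Proof. by move=> ZE; apply: eq_bigr => a _; rewrite ZE. Qed.

Lemma Bseries_stage_recursion i n : B i n = Bpart (@inTA M) (cZ0 Zw i) x0 t0 n +
  \sum_(m < M.+1) \sum_(j < s) \sum_(a < n.+1)
    Bpart (@inTA M) (cZ Zw m i j) (shift_fs (g_fs g c t0 h B m j) (n - a)%N) t0 a.
Proof.
apply: (Bseries_recursion phis0 phist) => [u uTA|u m ts uT uTA uE].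
  by have [->] := rec_TA uTA.
by have [->] := rec_g uT uTA uE.
Qed.

Lemma Bseries_final_recursion n : Bseries Phi x0 t0 n = Bpart (@inTA M) (cz0 Zw) x0 t0 n +
  \sum_(m < M.+1) \sum_(j < s) \sum_(a < n.+1)
    Bpart (@inTA M) (cz Zw m j) (shift_fs (g_fs g c t0 h B m j) (n - a)%N) t0 a.
Proof.
apply: (Bseries_recursion phis0 phist) => [u uTA|u m ts uT uTA uE].
  by have [_ ->] := rec_TA uTA.
by have [_ ->] := rec_g uT uTA uE.
Qed.

Lemma step_fs_Bseries (Zfs : coeffs M s (nat -> 'M[R]_d)) :
  coeffs_rel (coeff_fs A g t0) Zfs Zw ->
  step_fs g c x0 t0 h Zfs B (Bseries Phi x0 t0).
Proof.
move=> [Z0E ZE z0E zE]; split=> [i n|n].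
  rewrite Bseries_stage_recursion Z0E; congr (_ + _); apply: eq_bigr => m _.
  by apply: eq_bigr => j _; rewrite (mul_fs_Bpart _ _ (ZE m i j)).
rewrite Bseries_final_recursion z0E; congr (_ + _); apply: eq_bigr => m _.
by apply: eq_bigr => j _; rewrite (mul_fs_Bpart _ _ (zE m j)).
Qed.

(** The multiplication by g shifts the order by one, so the part of order [n] of
the right-hand side only involves the parts of lower order of the stages. *)
Lemma step_fs_unique (Zfs : coeffs M s (nat -> 'M[R]_d))
    (H H' : 'I_s -> nat -> vec) (Y Y' : nat -> vec) :
  step_fs g c x0 t0 h Zfs H Y -> step_fs g c x0 t0 h Zfs H' Y' ->
  (forall i, H i = H' i) /\ Y = Y'.
Proof.
move=> [HE YE] [HE' YE'].
have gext n m j : (forall k, (k <= n)%N -> H j k = H' j k) ->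
    g_fs g c t0 h H m j n = g_fs g c t0 h H' m j n.
  by move=> HH; apply: taylor_fs_ext => k kn; rewrite /point_fs HH.
have mext n m (Z : nat -> 'M[R]_d) j :
    (forall k, (k < n)%N -> H j k = H' j k) ->
    mul_fs Z (shift_fs (g_fs g c t0 h H m j)) n =
    mul_fs Z (shift_fs (g_fs g c t0 h H' m j)) n.
  move=> HH; apply: eq_bigr => a _; congr (_ *m _).
  case E: (n - a)%N => [//|l] /=; apply: gext => k kl; apply: HH.
  by rewrite (leq_ltn_trans kl)// -E leq_subr.
have HH n i : H i n = H' i n.
  elim/ltn_ind: n i => n IH i; rewrite HE HE'; congr (_ + _).
  apply: eq_bigr => m _; apply: eq_bigr => j _; apply: mext => k kn.
  exact: IH.
have HH' i : H i = H' i by apply/funext => n.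
split=> //; apply/funext => n; rewrite YE YE'; congr (_ + _).
by apply: eq_bigr => m _; apply: eq_bigr => j _; apply: mext => k _; rewrite HH'.
Qed.

Lemma step_fsP (Zfs : coeffs M s (nat -> 'M[R]_d)) H Y :
  coeffs_rel (coeff_fs A g t0) Zfs Zw ->
  step_fs g c x0 t0 h Zfs H Y <->
  (forall i, H i = Bseries (phis i) x0 t0) /\ Y = Bseries Phi x0 t0.
Proof.
move=> ZE; split=> [stepH|[HE ->]].
  exact: step_fs_unique stepH (step_fs_Bseries ZE).
suff -> : H = B by exact: step_fs_Bseries.
by apply/funext => i; rewrite HE.
Qed.

(** Grouping the terms of an absolutely convergent sum by order keeps it absolutely
convergent. *)
Lemma Bpart_abs_bound (D : {pred tree}) phi x t : {subset D <= @inT M} ->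
  (\esum_(u in [set u | u \in D]) `|(alpha R u * phi u) *: F u x t|%:E < +oo)%E ->
  exists K, forall i n, \sum_(k < n) `|Bpart D phi x t k i 0| <= K.
Proof.
move=> DT; set E := esum _ _ => Efin.
have E0 : (0 <= E)%E by apply: esum_ge0 => u _; rewrite lee_fin.
exists (fine E) => i n.
apply: (@le_trans _ _ (\sum_(k < n.+1) `|Bpart D phi x t k i 0|)).
  by rewrite [leRHS]big_ord_recr /= lerDl.
apply: (@le_trans _ _ (\sum_(u <- T_list M n | u \in D)
    `|(alpha R u * phi u) *: F u x t|)).
  apply: (@le_trans _ _ (\sum_(k < n.+1) \sum_(u <- T_list M n | u \in D)
      if nodes u == k then `|(alpha R u * phi u) *: F u x t| else 0)).
    apply: ler_sum => -[k kn] _ /=; rewrite ltnS in kn.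
    rewrite (BpartE A g phi x t DT kn) summxE (le_trans (ler_norm_sum _ _ _))//.
    rewrite -big_mkcondr; apply: ler_sum => u _; exact: entry_le_norm.
  rewrite exchange_big /= big_seq_cond [leRHS]big_seq_cond.
  apply: ler_sum => u; rewrite mem_T_list => /andP[/andP[_ un] _].
  by rewrite big_ord_eq.
rewrite -lee_fin fineK ?ge0_fin_numE//.
apply: esum_ge; exists [set` [seq u <- T_list M n | u \in D]].
  by split; [exact: finite_seq|move=> u; rewrite /mkset mem_filter => /andP[]].
rewrite -fsbig_seq ?filter_uniq ?T_list_uniq// big_filter.
by rewrite sumEFin.
Qed.

(** The homogeneous parts of a coefficient matrix, read off on the standard basis:
a B-series over trees without nodes of type g is linear in the vector. *)
Definition coeff_series (w : tree -> R) (n : nat) : 'M[R]_d :=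
  \matrix_(i, l) Bpart (@inTA M) w (delta_mx l 0) t0 n i 0.

Lemma coeff_seriesP w : coeff_fs A g t0 (coeff_series w) w.
Proof.
move=> n x; apply/matrixP => i j; rewrite ord1 mxE.
have xE : x = \sum_l x l 0 *: delta_mx l 0.
  apply/matrixP => k j'; rewrite ord1 summxE (bigD1 k)//= !mxE !eqxx mulr1.
  rewrite big1 ?addr0// => l lk; rewrite !mxE eq_sym (negbTE lk) mulr0//.
rewrite [in RHS]xE (BpartE A g w _ t0 inTA_inT (leqnn n)).
under [in RHS]eq_bigr => u /andP[uTA _].
  rewrite F_TA_sum//; under eq_bigr do rewrite F_TA_scale//.
  rewrite scaler_sumr; over.
rewrite exchange_big summxE; apply: eq_bigr => l _.
rewrite mxE (BpartE A g w _ t0 inTA_inT (leqnn n)) !summxE mulr_suml.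
by apply: eq_bigr => u _; rewrite !mxE [x l 0 * _]mulrC mulrA.
Qed.

Lemma coeff_series_cvg Zh w : coeff_sum A g t0 Zh w ->
  series (coeff_series w) @ \oo --> Zh.
Proof.
move=> Zsum; apply/cvg_mxP => i l; have [_ /cvg_mxP/(_ i 0)] := Zsum (delta_mx l 0).
rewrite -colE mxE; under eq_fun do rewrite series_coord.
under [in X in _ -> X]eq_fun do rewrite series_coord.
by under [in X in _ -> X]eq_fun do under eq_fun do rewrite mxE.
Qed.

Lemma coeff_series_bound Zh w : coeff_sum A g t0 Zh w ->
  exists K, forall i l n, \sum_(k < n) `|coeff_series w k i l| <= K.
Proof.
move=> Zsum; have HK l : exists K, forall i n,
    \sum_(k < n) `|Bpart (@inTA M) w (delta_mx l 0) t0 k i 0| <= K.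
  by apply: Bpart_abs_bound inTA_inT _; have [] := Zsum (delta_mx l 0).
have [K KP] := choice HK; exists (\big[Num.max/0]_l K l) => i l n.
rewrite (le_trans _ (le_bigmax _ K l))//.
by apply: le_trans (KP l i n); apply: ler_sum => k _; rewrite mxE.
Qed.

(** The sum over all orders of the identity of formal series.  The series of g_m is
not known to converge absolutely, but those of the coefficients do. *)
Lemma Bseries_cvg (Psi : tree -> R) (Z0 : tree -> R)
    (Zg : 'I_M.+1 -> 'I_s -> tree -> R) Z0h Zgh (H : 'I_s -> vec) :
  (forall n, Bseries Psi x0 t0 n = Bpart (@inTA M) Z0 x0 t0 n +
    \sum_(m < M.+1) \sum_(j < s) \sum_(a < n.+1)
      Bpart (@inTA M) (Zg m j) (shift_fs (g_fs g c t0 h B m j) (n - a)%N) t0 a) ->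
  coeff_sum A g t0 Z0h Z0 ->
  (forall m j, coeff_sum A g t0 (Zgh m j) (Zg m j)) ->
  (forall m j, series (g_fs g c t0 h B m j) @ \oo --> g m (H j) (t0 + c j * h)) ->
  series (Bseries Psi x0 t0) @ \oo --> Z0h *m x0 +
    \sum_(m < M.+1) \sum_(j < s) Zgh m j *m g m (H j) (t0 + c j * h).
Proof.
move=> rec Z0sum Zgsum gcvg.
have -> : series (Bseries Psi x0 t0) =
    (fun n => series (Bpart (@inTA M) Z0 x0 t0) n + \sum_(m < M.+1) \sum_(j < s)
       series (mul_fs (coeff_series (Zg m j)) (shift_fs (g_fs g c t0 h B m j))) n).
  apply/funext => n; rewrite /series /=; under eq_bigr do rewrite rec.
  rewrite big_split /=; congr (_ + _); rewrite exchange_big /=.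
  apply: eq_bigr => m _; rewrite exchange_big /=; apply: eq_bigr => j _.
  by apply: eq_bigr => k _; rewrite (mul_fs_Bpart _ _ (coeff_seriesP (Zg m j))).
apply: cvgD; first by have [] := Z0sum x0.
apply: cvg_big => [|m _]; first exact: add_continuous.
apply: cvg_big => [|j _]; first exact: add_continuous.
have [K KP] := coeff_series_bound (Zgsum m j).
apply: (mertens_mx KP); first exact: coeff_series_cvg.
exact: series_shift.
Qed.

Lemma Bsum_step (Zh : coeffs M s 'M[R]_d) (H : 'I_s -> vec) (v : vec) :
  coeffs_rel (coeff_sum A g t0) Zh Zw ->
  (forall i, Bsum A g (@inT M) (phis i) x0 t0 (H i)) ->
  Bsum A g (@inT M) Phi x0 t0 v ->
  (forall m j, series (g_fs g c t0 h B m j) @ \oo --> g m (H j) (t0 + c j * h)) ->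
  step g c x0 t0 h Zh H v.
Proof.
move=> [Z0S ZS z0S zS] HS [_ vS] gcvg; split=> [i|].
  have [_ Hi] := HS i.
  apply: (@cvg_unique _ (@norm_hausdorff _ _) _ _ _ _ Hi).
  exact: Bseries_cvg (Bseries_stage_recursion i) (Z0S i) (fun m j => ZS m i j) gcvg.
apply: (@cvg_unique _ (@norm_hausdorff _ _) _ _ _ _ vS).
exact: Bseries_cvg Bseries_final_recursion z0S zS gcvg.
Qed.

End Method.
End FormalSeriesOfTheMethod.

(** * Existence of the random weights *)

Section ExistenceOfWeights.
Variables (M s : nat) (R : realType) (disp : measure_display)
  (Omega : measurableType disp) (P : probability Omega R).
Variables (c : 'I_s -> R) (Z : coeffs M s (weight M P)).
Local Notation rv := {mfun Omega >-> R}.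

Lemma mfun_prodE (I : Type) (r : seq I) (f : I -> rv) (w : Omega) :
  (\prod_(i <- r) f i) w = \prod_(i <- r) f i w.
Proof. by elim/big_rec2: _ => //= i y ? _ <-. Qed.

(** The weight of a tree with [delta u = Gnode m ts], where [C m j] is the weight at
[theta u] of the coefficient in front of the j-th stage.  It is computed along
[u], down to the node of type g, because [delta u] is not a structural subterm.
Working in the ring of measurable functions makes measurability automatic. *)
Fixpoint weight_g (h : R) (u : tree M) : ('I_M.+1 -> 'I_s -> rv) -> rv :=
  match u with
  | Gnode m ts => fun C => \sum_(j < s) C m j * \prod_(x <- [seq
      if is_t v then cst (c j * h) : rv
      else if inTA v then cZ0 Z j v h : rv
      else weight_g h v (fun m' k => cZ Z m' j k (theta v) h) | v <- ts]) x
  | Anode ts => fun C => foldr (fun v x => if is_t v then x else weight_g h v C) 0 ts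
  | _ => fun _ => 0
  end.

Definition stage_weight (i : 'I_s) : weight M P := fun u h =>
  if is_t u then cst (c i * h) : rv
  else if inTA u then cZ0 Z i u h
  else weight_g h u (fun m k => cZ Z m i k (theta u) h).

Definition final_weight : weight M P := fun u h =>
  if inTA u then cz0 Z u h else weight_g h u (fun m k => cz Z m k (theta u) h).

Lemma weight_g_delta h C u : inT u -> weight_g h u C = weight_g h (delta u) C.
Proof.
move: u; apply: T_stem_ind => [//|m ts //|k b bT IH].
rewrite delta_stem ?inT_is_t// -IH /= foldr_stem ?inT_is_t//.
by case: b {bT IH}.
Qed.

Lemma weight_g_Gnode h C m ts (w : Omega) : weight_g h (Gnode m ts) C w =
  \sum_(j < s) C m j w * \prod_(v <- ts) stage_weight j v h w.
Proof.
rewrite /= mfun_sum; apply: eq_bigr => j _; rewrite mfunM /= big_map mfun_prodE.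
by [].
Qed.

Lemma weight_recursion_exists :
  (forall i h w, cZ0 Z i Tempty h w = 1) -> (forall h w, cz0 Z Tempty h w = 1) ->
  weight_recursion c Z stage_weight final_weight.
Proof.
move=> Z0_empty z0_empty h w; split.
- by split=> [i|]; [exact: Z0_empty|exact: z0_empty].
- split=> // i m; rewrite -[LHS]/(weight_g h (Gnode m [::]) _ w) weight_g_Gnode.
  by apply: eq_bigr => j _; rewrite big_nil mulr1.
- move=> m; rewrite -[LHS]/(weight_g h (Gnode m [::]) _ w) weight_g_Gnode.
  by apply: eq_bigr => j _; rewrite big_nil mulr1.
- move=> u uTA; have := inT_is_t (proj1 (andP uTA)) => /negbTE ut.
  by rewrite /stage_weight /final_weight ut uTA.
- move=> u m ts uT /negbTE uTA uE; rewrite /final_weight uTA.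
  rewrite weight_g_delta// uE; split; last exact: weight_g_Gnode.
  move=> i; rewrite {1}/stage_weight (negbTE (inT_is_t uT)) uTA.
  by rewrite weight_g_delta// uE; exact: weight_g_Gnode.
Qed.

End ExistenceOfWeights.

Theorem theorem3 (R : realType) (d M s : nat)
    (disp : measure_display) (Omega : measurableType disp)
    (P : probability Omega R)
    (A : R -> 'M[R]_d) (g : 'I_M.+1 -> 'cV[R]_d -> R -> 'cV[R]_d)
    (A_smooth : forall (k : nat) (t : R), derivable (derive1n k A) t 1)
    (g_smooth : forall m, smooth (uncurry_g g m))
    (x0 : 'cV[R]_d) (t0 : R) (c : 'I_s -> R)
    (Z : coeffs M s (weight M P))
    (Z0_empty : forall i h w, cZ0 Z i Tempty h w = 1)
    (z0_empty : forall h w, cz0 Z Tempty h w = 1) :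
  (exists (Phis : 'I_s -> weight M P) (Phi : weight M P),
      weight_recursion c Z Phis Phi)
  /\
  forall (Phis : 'I_s -> weight M P) (Phi : weight M P),
    weight_recursion c Z Phis Phi ->
    forall (h : R) (w : Omega),
      (forall Zfs : coeffs M s (nat -> 'M[R]_d),
         coeffs_rel (coeff_fs A g t0) Zfs (coeffs_at h w Z) ->
         forall (H : 'I_s -> nat -> 'cV[R]_d) (Y : nat -> 'cV[R]_d),
           step_fs g c x0 t0 h Zfs H Y
           <-> (forall i, H i = Bseries A g (weight_at h w (Phis i)) x0 t0)
               /\ Y = Bseries A g (weight_at h w Phi) x0 t0)
      /\
      (forall Zh : coeffs M s 'M[R]_d,
         coeffs_rel (coeff_sum A g t0) Zh (coeffs_at h w Z) ->
         forall H : 'I_s -> 'cV[R]_d,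
           (forall i, Bsum A g (@inT M) (weight_at h w (Phis i)) x0 t0 (H i)) ->
           (exists v, Bsum A g (@inT M) (weight_at h w Phi) x0 t0 v) ->
           (forall m j,
              series (g_fs g c t0 h
                        (fun i => Bseries A g (weight_at h w (Phis i)) x0 t0) m j)
                @ \oo --> g m (H j) (t0 + c j * h)) ->
           exists2 Y : 'cV[R]_d,
             step g c x0 t0 h Zh H Y
             & Bsum A g (@inT M) (weight_at h w Phi) x0 t0 Y).
Proof.
split.
  exists (stage_weight c Z), (final_weight c Z).
  exact: weight_recursion_exists.
move=> Phis Phi rec h w.
have [[phis0 _] [_ phist] _ recTA recg] := rec h w.
have rec0 j : weight_at h w (Phis j) Tempty = 1 by exact: phis0.
have rect j : weight_at h w (Phis j) Tnode = c j * h by exact: phist.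
pose Zw := coeffs_at h w Z.
pose phis i := weight_at h w (Phis i).
pose phi := weight_at h w Phi.
split=> [Zfs ZE H Y|Zh ZE H HS [v vS] gcvg].
  exact: (step_fsP g_smooth x0 (Zw := Zw) (phis := phis) (Phi := phi)
    rec0 rect recTA recg H Y ZE).
exists v => //.
exact: (Bsum_step g_smooth (Zw := Zw) (phis := phis) (Phi := phi)
  rec0 rect recTA recg ZE HS vS).
Qed.
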